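(* Let $n\ge1$ be an integer, $H\in(n-1,n)$, $T>0$ and $u\in[0,T]$. The regular conditional distribution of the $n$th order fractional Brownian motion $B_H^{(n)}=(B_H^{(n)}(t),t\in[0,T])$ conditioned on the information $\mathcal{F}_{B_H^{(n)}}(u)=\sigma\{B_H^{(n)}(v):v\le u\}$ is that of a Gaussian process with random mean $\hat B_H^{(n)}(\cdot|u)$ given by $$\hat B_H^{(n)}(t|u)=B_H^{(n)}(u)+\int_0^u\left[k_H^{(n)}(t,v)-k_H^{(n)}(u,v)\right]\mathrm{d}W(v)$$ and deterministic covariance $\hat r_H^{(n)}(\cdot,\cdot|u)$ given by $$\hat r_H^{(n)}(t,s|u)=r_H^{(n)}(t,s)-\int_0^u k_H^{(n)}(t,v)\,k_H^{(n)}(s,v)\,\mathrm{d}v .$$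
   Context: **Kernels.** For $h\in(0,1)$ and $0<s<t$, $$k_h(t,s)=d_h\left[\left(\tfrac{t}{s}\right)^{h-\frac12}(t-s)^{h-\frac12}-\left(h-\tfrac12\right)s^{\frac12-h}\int_s^t z^{h-\frac32}(z-s)^{h-\frac12}\,\mathrm{d}z\right],\quad d_h=\sqrt{\frac{2h\,\Gamma(\frac32-h)}{\Gamma(h+\frac12)\Gamma(2-2h)}}.$$ For $n=1$, $H\in(0,1)$: $k_H^{(1)}=k_H$. For $n\ge2$, $H\in(n-1,n)$: $k_H^{(n)}(t,u)=\int_u^t k_{H-1}^{(n-1)}(s,u)\,\mathrm{d}s$ for $0<u<t$. All are Volterra kernels: $k_H^{(n)}(t,v)=0$ for $v\ge t$. **The process.** The $n$th order fractional Brownian motion with Hurst index $H$ is $B_H^{(n)}(t)=\int_0^t k_H^{(n)}(t,v)\,\mathrm{d}W(v)$, where $W$ is the associated standard Brownian motion, which generates the same filtration as $B_H^{(n)}$ (up to null sets): $\sigma\{W(v):v\le t\}=\sigma\{B_H^{(n)}(v):v\le t\}$ for all $t$. Its covariance function is $r_H^{(n)}(t,s)=\mathbb{E}[B_H^{(n)}(t)B_H^{(n)}(s)]$. *)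

(* Defs.v *)
From HB Require Import structures.
From mathcomp Require Import all_boot all_order all_algebra.
From mathcomp Require Import all_classical all_reals all_analysis.
From mathcomp Require Import measurable_realfun.

Set Implicit Arguments.
Unset Strict Implicit.
Unset Printing Implicit Defensive.

Import Order.TTheory GRing.Theory Num.Theory.
Import numFieldNormedType.Exports.

Local Open Scope classical_set_scope.
Local Open Scope ring_scope.

Section kernels.
Context {R : realType}.
Implicit Types a h H t s u : R.
Local Notation leb := (@lebesgue_measure R).

Definition Gamma a : R :=
  \int[leb]_(x in `]0, +oo[) (x `^ (a - 1) * expR (- x)).

Definition mg_const h : R :=
  Num.sqrt (2 * h * Gamma (3 / 2 - h) / (Gamma (h + 1 / 2) * Gamma (2 - 2 * h))).

Definition mg_kernel h t s : R :=
  if (0 < s) && (s < t) then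
    mg_const h *
    ((t / s) `^ (h - 1 / 2) * (t - s) `^ (h - 1 / 2)
     - (h - 1 / 2) * s `^ (1 / 2 - h) *
       \int[leb]_(z in `[s, t]) (z `^ (h - 3 / 2) * (z - s) `^ (h - 1 / 2)))
  else 0.

(* Only orders [n >= 1] are meaningful; [n = 0] is a dummy case. *)
Fixpoint fbm_kernel (n : nat) H t u : R :=
  match n with
  | 0 => 0
  | m.+1 =>
    match m with
    | 0 => mg_kernel H t u
    | _ => if (0 < u) && (u < t) then
             \int[leb]_(s in `[u, t]) fbm_kernel m (H - 1) s u
           else 0
    end
  end.

End kernels.

Section brownian_motion.
Context {R : realType} {d : measure_display} {Omega : measurableType d}.
Variable P : probability Omega R.

(* The sets [A i] may be [setT], so the product rule for the whole family
   contains the product rule for every subfamily. *)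
Definition independent_rvs n (X : 'I_n -> Omega -> R) : Prop :=
  forall A : 'I_n -> set R, (forall i, measurable (A i)) ->
    P (\bigcap_(i in [set: 'I_n]) X i @^-1` A i)
    = (\prod_(i < n) P (X i @^-1` A i))%E.

Definition subdivision (a b : R) (n : nat) (t : nat -> R) : Prop :=
  [/\ a <= t 0%N, (forall i, (i < n)%N -> t i <= t i.+1) & t n <= b].

Record brownian_motion (T : R) (W : R -> {RV P >-> R}) : Prop := {
  bm_start : {ae P, forall w, W 0 w = 0} ;
  bm_indep : forall n (t : nat -> R), subdivision 0 T n t ->
    independent_rvs (fun (i : 'I_n) w => W (t i.+1) w - W (t i) w) ;
  bm_normal : forall s t : R, 0 <= s -> s < t -> t <= T ->
    forall A : set R, measurable A ->
    P ((fun w => W t w - W s w) @^-1` A) = normal_prob 0 (Num.sqrt (t - s)) A ;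
  bm_continuous :
    {ae P, forall w, {within `[0, T], continuous (fun t : R => W t w)}} }.

Definition step_fun n (t c : nat -> R) (x : R) : R :=
  \sum_(i < n) c i * \1_(`]t i, t i.+1]%classic) x.

Definition step_integral (W : R -> Omega -> R) n (t c : nat -> R) (w : Omega) : R :=
  \sum_(i < n) c i * (W (t i.+1) w - W (t i) w).

(* [X] is a version of the integral over [a, b] of the deterministic,
   square-integrable [f] against [W]: the L^2(P)-limit of the integrals of step
   functions that converge to [f] in L^2([a, b]). *)
Definition wiener_integral (W : R -> Omega -> R) (a b : R) (f : R -> R)
    (X : Omega -> R) : Prop :=
  [/\ measurable_fun `[a, b] f,
      (\int[lebesgue_measure]_(x in `[a, b]) (f x ^+ 2)%:E < +oo)%E,
      measurable_fun [set: Omega] X &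
      exists (n : nat -> nat) (t c : nat -> nat -> R),
      [/\ (forall k, subdivision a b (n k) (t k)),
          (fun k => \int[lebesgue_measure]_(x in `[a, b])
             ((f x - step_fun (n k) (t k) (c k) x) ^+ 2)%:E)%E @ \oo --> 0%E &
          (fun k => 'E_P[fun w =>
             ((X w - step_integral W (n k) (t k) (c k) w) ^+ 2)%R])%E
            @ \oo --> 0%E]].

End brownian_motion.

Section filtration.
Context {R : realType} {d : measure_display} {Omega : measurableType d}.

(* Generators of sigma(X v : 0 <= v <= t). *)
Definition history (X : R -> Omega -> R) (t : R) : set (set Omega) :=
  [set C | exists (v : R) (A : set R), [/\ 0 <= v <= t, measurable A & C = X v @^-1` A]].

Definition sub_mod_null (P : probability Omega R) (F G : set (set Omega)) : Prop :=
  forall C, F C -> exists2 D, G D & P ((C `\` D) `|` (D `\` C)) = 0%E.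

Definition eq_mod_null (P : probability Omega R) (F G : set (set Omega)) : Prop :=
  sub_mod_null P F G /\ sub_mod_null P G F.

End filtration.

Section path_space.
Context {R : realType}.

Definition time (T : R) : Type := {t : R | 0 <= t <= T}.

Definition cylinder (T : R) : set (set (time T -> R)) :=
  [set C | exists (t : time T) (A : set R),
     measurable A /\ C = (fun x : time T -> R => x t) @^-1` A].

(* R^[0, T] with the product sigma-algebra. *)
Notation path_space T := (g_sigma_algebraType (@cylinder T)).

Definition path_of (Omega : Type) (T : R) (X : R -> Omega -> R) (w : Omega) :
  path_space T := fun t => X (sval t) w.

(* [normal_prob m 0] is not the degenerate law, and its second argument is a
   standard deviation. *)
Definition gaussian_law (m v : R) (A : set R) : \bar R :=
  if v == 0 then dirac m A else normal_prob m (Num.sqrt v) A.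

Definition gaussian_process d (E : measurableType d) (Q : probability E R)
    (I : Type) (X : I -> E -> R) : Prop :=
  forall n (t : 'I_n -> I) (a : 'I_n -> R),
  exists m v, 0 <= v /\
    forall A : set R, measurable A ->
    Q ((fun x => \sum_(i < n) a i * X (t i) x) @^-1` A) = gaussian_law m v A.

Definition gaussian_path_law (T : R) (Q : probability (path_space T) R)
    (m : time T -> R) (r : time T -> time T -> \bar R) : Prop :=
  let X := fun (t : time T) (x : path_space T) => x t in
  [/\ gaussian_process Q X,
      (forall t, 'E_Q[X t] = (m t)%:E)%E &
      forall t s, covariance Q (X t) (X s) = r t s].

(* [Q] is a regular conditional distribution of [X] given the sigma-algebra
   generated by [G]. *)
Definition regular_conditional_distribution d (Omega : measurableType d)
    (P : probability Omega R) (G : set (set Omega))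
    d' (E : measurableType d') (X : Omega -> E) (Q : Omega -> probability E R) :
    Prop :=
  (forall A : set E, measurable A ->
    measurable_fun [set: g_sigma_algebraType G] (fun w => Q w A)) /\
  (forall (D : set Omega) (A : set E), <<s G >> D -> measurable A ->
    P (D `&` X @^-1` A) = \int[P]_(w in D) Q w A)%E.

End path_space.

Notation path_space T := (g_sigma_algebraType (@cylinder _ T)).

Section prediction.
Context {R : realType} {d : measure_display} {Omega : measurableType d}.
Variable P : probability Omega R.
Variables (n : nat) (H T : R).
Variables W B : R -> {RV P >-> R}.

Definition nfbm : Prop :=
  forall t : R, 0 <= t <= T -> wiener_integral P W 0 t (fbm_kernel n H t) (B t).

Definition nfbm_covariance (t s : R) : \bar R :=
  ('E_P[fun w => (B t w * B s w)%R])%E.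

(* Each [M t] is a version of
   [B u + int_0^u (k(t, v) - k(u, v)) dW(v)], chosen measurable with respect to
   sigma(B v : v <= u). *)
Definition prediction_mean (u : R) (M : R -> Omega -> R) : Prop :=
  forall t : R, 0 <= t <= T ->
    measurable_fun [set: g_sigma_algebraType (history B u)] (M t) /\
    wiener_integral P W 0 u (fun v => fbm_kernel n H t v - fbm_kernel n H u v)
      (fun w => M t w - B u w).

Definition prediction_covariance (u t s : R) : \bar R :=
  (nfbm_covariance t s
   - \int[lebesgue_measure]_(v in `[0%R, u])
       (fbm_kernel n H t v * fbm_kernel n H s v)%:E)%E.

End prediction.

(* Main.v *)
(* Let k_t = k(t, .), which vanishes outside (0, t). The Wiener integral of k_t
   over [0, T] splits at u: the part over [0, u] is a.s. the prediction M_t, and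
   the residual Z_t = B_t - M_t is a.s. the integral of k_t over (u, T]. The
   former is measurable with respect to the past of W, the latter is a function
   of the increments of W after u, so Z is independent of the past, and the
   conditional law of B = M + Z given the past is the law of M(w) + Z with w
   frozen. Linear combinations of the Z_t are Wiener integrals, hence L^2-limits
   of sums of independent centred normal variables, hence centred normal; the
   isometry E[Z_t Z_s] = int_u^T k_t k_s = E[B_t B_s] - int_0^u k_t k_s gives the
   covariance.

   Sums of independent normal variables are handled by convolving densities,
   their limits by testing against continuous functions, and the variance of the
   standard normal law by a scaling argument. *)
Require Import Defs.
From HB Require Import structures.
From mathcomp Require Import all_boot all_order all_algebra.
From mathcomp Require Import all_classical all_reals all_analysis.
From mathcomp Require Import measurable_realfun.
From mathcomp Require Import ring lra.

Set Implicit Arguments.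
Unset Strict Implicit.
Unset Printing Implicit Defensive.

Import Order.TTheory GRing.Theory Num.Theory.
Import numFieldNormedType.Exports.

Local Open Scope classical_set_scope.
Local Open Scope ring_scope.

(** * Square-integrable functions *)

(** The obstacle is almost-sure ambiguity. Wiener integrals are determined only up to null sets, the
    pasts of [W] and [B] agree only modulo null sets, and [W 0] vanishes only almost surely, whereas
    a regular conditional distribution must be exactly measurable with respect to the past of [B].
    So events are compared inside [null_completion], and exactly measurable versions are selected
    where a random variable itself is needed. The mean [M] is an arbitrary version; uniqueness of
    the Wiener integral ties it to the splitting at u. What is split is B_t - B_u, the integral of
    k_t - k_u over [0, T]: its part over [0, u] is M_t - B_u, and after u the kernel k_u vanishes,
    so the other part involves k_t alone. Zero variances cannot be excluded, since the residual is
    a.s. 0 for t <= u. All normal laws are therefore treated as images of the standard one under x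
    |-> sqrt(v) x + m. *)

Definition sqint {R : realType} d {T : measurableType d}
  (mu : {measure set T -> \bar R}) (f : T -> R) : \bar R :=
  (\int[mu]_x ((f x) ^+ 2)%:E)%E.

Section square_integrals.
Context {R : realType} d {T : measurableType d} (mu : {measure set T -> \bar R}).
Implicit Types f g : T -> R.
Local Notation mfun f := (measurable_fun [set: T] f).
Local Notation sqint := (sqint mu).

Lemma measurable_sqr f : mfun f -> mfun (fun x => ((f x) ^+ 2)%:E).
Proof. by move=> mf; apply/measurable_EFinP/measurable_funX. Qed.

Lemma sqint_ge0 f : (0 <= sqint f)%E.
Proof. by apply: integral_ge0 => x _; rewrite lee_fin sqr_ge0. Qed.

Lemma sqintZ (a : R) f : mfun f ->
  sqint (fun x => a * f x) = ((a ^+ 2)%:E * sqint f)%E.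
Proof.
move=> mf; rewrite /sqint -ge0_integralZl_EFin//.
- by apply: eq_integral => x _; rewrite exprMn EFinM.
- by move=> x _; rewrite lee_fin sqr_ge0.
- exact: measurable_sqr.
- exact: sqr_ge0.
Qed.

Lemma sqintN f : sqint (fun x => - f x) = sqint f.
Proof. by apply: eq_integral => x _; rewrite sqrrN. Qed.

Lemma sqint_le f g : mfun f -> mfun g ->
  (forall x, `|f x| <= `|g x|) -> (sqint f <= sqint g)%E.
Proof.
move=> mf mg fg; apply: ge0_le_integral => //.
- by move=> x _; rewrite lee_fin sqr_ge0.
- exact: measurable_sqr.
- exact: measurable_sqr.
- move=> x _; rewrite lee_fin -(real_normK (num_real (f x))).
  by rewrite -(real_normK (num_real (g x))) lerXn2r// ?nnegrE.
Qed.

Lemma eq_ae_sqint f g : mfun f -> mfun g ->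
  {ae mu, forall x, f x = g x} -> sqint f = sqint g.
Proof.
move=> mf mg fg; apply: ge0_ae_eq_integral => //.
- exact: measurable_sqr.
- exact: measurable_sqr.
- by move=> x _; rewrite lee_fin sqr_ge0.
- by move=> x _; rewrite lee_fin sqr_ge0.
- by apply: filterS fg => x /= -> _.
Qed.

Lemma sqint_eq0 f : mfun f -> sqint f = 0%E -> {ae mu, forall x, f x = 0}.
Proof.
move=> mf f0; have /ae_eq_integral_abs : measurable_fun setT (fun x => ((f x) ^+ 2)%:E).
  exact: measurable_sqr.
move=> /(_ mu measurableT)[+ _].
rewrite (eq_integral (fun x => ((f x) ^+ 2)%:E)); last first.
  by move=> x _; rewrite /= ger0_norm ?sqr_ge0.
move=> /(_ f0); apply: filterS => x /(_ I)[] /eqP.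
by rewrite sqrf_eq0 => /eqP.
Qed.

Lemma integrable_sqr f : mfun f -> (sqint f < +oo)%E ->
  mu.-integrable setT (fun x => ((f x) ^+ 2)%:E).
Proof.
move=> mf foo; apply/integrableP; split; first exact: measurable_sqr.
by under eq_integral do rewrite /= ger0_norm ?sqr_ge0//.
Qed.

Lemma integrable_mul_sqr f g : mfun f -> mfun g ->
  (sqint f < +oo)%E -> (sqint g < +oo)%E ->
  mu.-integrable setT (fun x => (f x * g x)%:E).
Proof.
move=> mf mg foo goo.
have := integrableD measurableT (integrable_sqr mf foo) (integrable_sqr mg goo).
apply: le_integrable => //.
  exact/measurable_EFinP/measurable_funM.
move=> x _ /=; rewrite lee_fin normrM [leRHS]ger0_norm ?addr_ge0 ?sqr_ge0//.
rewrite -(real_normK (num_real (f x))) -(real_normK (num_real (g x))).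
have : 0 <= (`|f x| - `|g x|) ^+ 2 + `|f x| ^+ 2 + `|g x| ^+ 2.
  by rewrite !addr_ge0// sqr_ge0.
by nra.
Qed.

Lemma sqintD f g : mfun f -> mfun g ->
  (sqint f < +oo)%E -> (sqint g < +oo)%E ->
  (sqint (fun x => f x + g x)%R
   = sqint f + sqint g + 2%:E * \int[mu]_x (f x * g x)%R%:E)%E.
Proof.
move=> mf mg foo goo; rewrite /sqint.
have i1 := integrable_sqr mf foo; have i2 := integrable_sqr mg goo.
have i3 := integrable_mul_sqr mf mg foo goo.
rewrite -integralZl// -integralD//=.
rewrite -integralD//=.
- by apply: eq_integral => x _; rewrite -EFinM -!EFinD; congr EFin; ring.
- exact: integrableD.
- exact: (@integrableZl _ _ _ mu setT measurableT 2 _ i3).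
Qed.

(** Pointwise, the right side exceeds the left by e^-1 (e f - g)^2. The weight stays free because
    [cvg_sqint] needs a factor close to 1 in front of one norm; e = 1 gives the usual factors 2. *)
Lemma sqintD_le_weighted (e : R) f g : 0 < e -> mfun f -> mfun g ->
  (sqint (fun x => f x + g x)%R
   <= (1 + e)%:E * sqint f + (1 + e^-1)%:E * sqint g)%E.
Proof.
move=> e0 mf mg; have ei0 : 0 < e^-1 by rewrite invr_gt0.
have [c1 c2] : 0 <= 1 + e /\ 0 <= 1 + e^-1 by rewrite !addr_ge0// ltW.
have sqr_pos (h : T -> R) x : (0 <= ((h x) ^+ 2)%:E)%E by rewrite lee_fin sqr_ge0.
rewrite /sqint -!ge0_integralZl_EFin//; try exact: measurable_sqr.
rewrite -ge0_integralD//=; last 4 first.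
- by move=> x _; rewrite -EFinM lee_fin mulr_ge0// sqr_ge0.
- by apply: emeasurable_funM => //; exact: measurable_sqr.
- by move=> x _; rewrite -EFinM lee_fin mulr_ge0// sqr_ge0.
- by apply: emeasurable_funM => //; exact: measurable_sqr.
apply: ge0_le_integral => //.
- by move=> x _; rewrite lee_fin sqr_ge0.
- by apply: measurable_sqr; exact: measurable_funD.
- by apply: emeasurable_funD; apply: emeasurable_funM => //; exact: measurable_sqr.
- move=> x _; rewrite -!EFinM -EFinD lee_fin.
  have : 0 <= e^-1 * (e * f x - g x) ^+ 2 by rewrite mulr_ge0 ?sqr_ge0// ltW.
  have -> : e^-1 * (e * f x - g x) ^+ 2
    = (1 + e) * f x ^+ 2 + (1 + e^-1) * g x ^+ 2 - (f x + g x) ^+ 2.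
    by field; rewrite gt_eqF.
  by rewrite subr_ge0.
Qed.

Lemma sqintD_le f g : mfun f -> mfun g ->
  (sqint (fun x => f x + g x)%R <= 2%:E * sqint f + 2%:E * sqint g)%E.
Proof.
by move=> mf mg; have := sqintD_le_weighted ltr01 mf mg; rewrite invr1.
Qed.

Lemma sqintB_le f g : mfun f -> mfun g ->
  (sqint (fun x => f x - g x)%R <= 2%:E * sqint f + 2%:E * sqint g)%E.
Proof.
move=> mf mg; rewrite -(sqintN g); apply: sqintD_le => //.
exact: measurableT_comp.
Qed.

Lemma sqintD_lty f g : mfun f -> mfun g ->
  (sqint f < +oo)%E -> (sqint g < +oo)%E ->
  (sqint (fun x => f x + g x)%R < +oo)%E.
Proof.
move=> mf mg foo goo; apply: le_lt_trans (sqintD_le mf mg) _.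
by rewrite lte_add_pinfty// lte_mul_pinfty.
Qed.

Lemma sqintZ_lty (a : R) f : mfun f -> (sqint f < +oo)%E ->
  (sqint (fun x => a * f x)%R < +oo)%E.
Proof.
by move=> mf foo; rewrite sqintZ// lte_mul_pinfty// ?lee_fin ?sqr_ge0.
Qed.

Lemma cvg_sqintD f g (s t : nat -> T -> R) : mfun f -> mfun g ->
  (forall k, mfun (s k)) -> (forall k, mfun (t k)) ->
  (fun k => sqint (fun x => f x - s k x)) @ \oo --> 0%E ->
  (fun k => sqint (fun x => g x - t k x)) @ \oo --> 0%E ->
  (fun k => sqint (fun x => (f x + g x) - (s k x + t k x))) @ \oo --> 0%E.
Proof.
move=> mf mg ms mt fs gt.
have lim0 : (fun k => 2%:E * sqint (fun x => f x - s k x)%R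
    + 2%:E * sqint (fun x => g x - t k x)%R)%E @ \oo --> 0%E.
  rewrite [X in _ --> X](_ : _ = 2%:E * 0 + 2%:E * 0)%E; last by rewrite !mule0 adde0.
  by apply: cvgeD; [rewrite !mule0|exact: cvgeZl..].
apply: squeeze_cvge (cvg_cst 0%E) lim0.
apply: nearW => k; rewrite sqint_ge0/=.
rewrite (_ : (fun x => _) = fun x => (f x - s k x) + (g x - t k x)).
  by apply: sqintD_le; exact: measurable_funB.
by apply/funext => x; ring.
Qed.

Lemma cvg_sqintZ (a : R) f (s : nat -> T -> R) : mfun f ->
  (forall k, mfun (s k)) ->
  (fun k => sqint (fun x => f x - s k x)) @ \oo --> 0%E ->
  (fun k => sqint (fun x => a * f x - a * s k x)) @ \oo --> 0%E.
Proof.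
move=> mf ms fs.
rewrite (_ : (fun k => _) =
    fun k => ((a ^+ 2)%:E * sqint (fun x => f x - s k x)%R)%E); last first.
  apply/funext => k; rewrite -sqintZ; last exact: measurable_funB.
  by apply: eq_integral => x _; congr ((_ ^+ 2)%:E); rewrite mulrBr.
rewrite -(mule0 (a ^+ 2)%:E).
exact: cvgeZl.
Qed.

End square_integrals.

(** * Almost-everywhere subsequences, completeness and continuity of the norm in L^2 *)

Section square_integral_limits.
Context {R : realType} d {T : measurableType d} (mu : {measure set T -> \bar R}).
Implicit Types f g : T -> R.
Local Notation mfun f := (measurable_fun [set: T] f).
Local Notation sqint := (sqint mu).
Local Notation q j := ((2^-1 : R) ^+ j.+1).

Lemma le_nneseries_term (u : nat -> \bar R) j : (forall n, 0 <= u n)%E ->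
  (u j <= \sum_(n <oo) u n)%E.
Proof.
move=> u0; have := @nneseries_lim_ge R u xpredT 0%N j.+1.
move=> /(_ (fun n _ _ => u0 n)); apply: le_trans.
by rewrite big_nat_recr//= leeDr// sume_ge0.
Qed.

Lemma cvge0P (u : nat -> \bar R) : (forall k, 0 <= u k)%E ->
  (u @ \oo --> 0%E) <->
  (forall e : R, 0 < e -> exists N, forall k, (N <= k)%N -> (u k <= e%:E)%E).
Proof.
move=> u0; split=> [ucvg e e0|ue].
  have e0' : (0 < e%:E)%E by rewrite lte_fin.
  have [N _ NP] := ucvg _ (open_ereal_lt' e0').
  by exists N => k Nk; exact/ltW/NP.
apply/fine_cvgP; split.
  have [N NP] := ue 1 ltr01; exists N => // k /= /NP uk.
  by rewrite ge0_fin_numE// (le_lt_trans uk)// ltry.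
apply/cvgrPdist_le => e e0; have [N NP] := ue e e0; exists N => // k /= /NP uk.
rewrite sub0r normrN ger0_norm ?fine_ge0// -lee_fin fineK//.
by rewrite ge0_fin_numE// (le_lt_trans uk)// ltry.
Qed.

(* The weighted sum of the [8^j (h j)^2 / 2^j] has finite integral. *)
Lemma ae_geometric_bound (h : nat -> T -> R) : (forall j, mfun (h j)) ->
  (forall j, sqint (h j) <= (q j ^+ 3)%:E)%E ->
  {ae mu, forall x, exists C : R, forall j, `|h j x| <= C * q j}.
Proof.
move=> mh hq; pose g j x := ((q j ^- 2 * (h j x) ^+ 2)%:E).
have q0 j : 0 < q j by rewrite exprn_gt0.
have g0 j x : (0 <= g j x)%E by rewrite lee_fin mulr_ge0 ?sqr_ge0// invr_ge0 sqr_ge0.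
have mg j : mfun (g j).
  apply/measurable_EFinP; apply: measurable_funM => //.
  exact: measurable_funX.
have : mu.-integrable setT (fun x => \sum_(j <oo) g j x)%E.
  apply/integrableP; split; first exact: ge0_emeasurable_sum.
  under eq_integral do rewrite gee0_abs ?nneseries_ge0//.
  rewrite integral_nneseries//; apply: (@le_lt_trans _ _ 1%E); last exact: ltry.
  apply: le_trans (epsilon_trick0 xpredT ler01).
  apply: lee_nneseries => j _; first by rewrite integral_ge0.
  rewrite /g; under eq_integral do rewrite EFinM.
  rewrite ge0_integralZl_EFin//; last 2 first.
  - by move=> x _; rewrite lee_fin sqr_ge0.
  - exact: measurable_sqr.
  apply: (@le_trans _ _ ((q j ^- 2)%:E * (q j ^+ 3)%:E)%E).
    by apply: lee_wpmul2l; rewrite ?lee_fin ?invr_ge0 ?sqr_ge0//; exact: hq.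
  rewrite -EFinM lee_fin exprS mulrA mulrAC mulVf ?mul1r ?expf_neq0 ?gt_eqF//.
  by rewrite natrX exprVn.
move=> /integrable_ae => /(_ measurableT); apply: filterS => x /(_ I).
case E : (\sum_(j <oo) g j x)%E => [C| |]// _.
exists (C + 1) => j; have := le_nneseries_term j (g0^~ x).
rewrite E lee_fin -/(g j x) mulrC ler_pdivrMr ?exprn_gt0// => hC.
have C0 : 0 <= C.
  by rewrite -lee_fin -E; apply: nneseries_ge0 => n _ _; exact: g0.
rewrite -ler_sqr ?nnegrE ?mulr_ge0 ?addr_ge0// ?(ltW (q0 j))//.
rewrite real_normK ?num_real//. rewrite (le_trans hC)// exprMn ler_wpM2r ?sqr_ge0//.
by nra.
Qed.

Lemma cvg_half_powers (C : R) (u : nat -> R) :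
  (forall j, `|u j| <= C * q j) -> u @ \oo --> 0.
Proof.
move=> uC; apply/norm_cvg0P.
have lim0 : (fun j => C * q j) @ \oo --> (0 : R).
  rewrite -(mulr0 C); apply: cvgMr.
  have : (GRing.exp (2^-1 : R) : nat -> R) @ \oo --> (0 : R).
    by apply: cvg_expr; rewrite ger0_norm// invf_lt1// ltr1n.
  by rewrite -cvg_shiftS.
apply: squeeze_cvgr (cvg_cst 0) lim0.
by apply: nearW => j; rewrite normr_ge0 uC.
Qed.

(** Choosing squared errors at most 8^-(j+1) makes [ae_geometric_bound] applicable. The bound j <=
    phi j ensures that limits along the whole sequence persist along phi. *)
Lemma ae_cvg_subsequence f (s : nat -> T -> R) : mfun f ->
  (forall k, mfun (s k)) ->
  (fun k => sqint (fun x => f x - s k x)) @ \oo --> 0%E ->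
  exists2 phi : nat -> nat, (forall j, j <= phi j)%N &
    {ae mu, forall x, (fun j => s (phi j) x) @ \oo --> f x}.
Proof.
move=> mf ms fs.
have /choice[phi phiP] : forall j, exists k, (j <= k)%N /\
    (sqint (fun x => f x - s k x)%R <= (q j ^+ 3)%:E)%E.
  move=> j; have q0 : 0 < q j ^+ 3 by rewrite !exprn_gt0.
  have [N NP] := (cvge0P (fun k => sqint_ge0 mu _)).1 fs _ q0.
  exists (maxn j N); rewrite leq_maxl; split => //.
  by apply: NP; rewrite leq_maxr.
exists phi => [j|]; first by have [] := phiP j.
have : {ae mu, forall x, exists C : R, forall j, `|f x - s (phi j) x| <= C * q j}.
  apply: (@ae_geometric_bound (fun j x => f x - s (phi j) x)) => j.
    exact: measurable_funB.
  by have [] := phiP j.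
apply: filterS => x [C] /cvg_half_powers /= fs0.
have -> : (fun j => s (phi j) x) = (fun j => f x - (f x - s (phi j) x)).
  by apply/funext => j; ring.
rewrite -[X in _ --> X]subr0; apply: cvgB => //.
exact: cvg_cst.
Qed.

Lemma limn_einf_le (u : nat -> \bar R) (l : \bar R) K :
  (forall j, (K <= j)%N -> (u j <= l)%E) -> (limn_einf u <= l)%E.
Proof.
move=> uK; rewrite limn_einf_lim; apply: lime_le; first exact: is_cvg_einfs.
apply: nearW => n; apply: (@le_trans _ _ (u (maxn n K))).
  by apply: ereal_inf_lbound; exists (maxn n K) => //=; rewrite leq_maxl.
by apply: uK; rewrite leq_maxr.
Qed.

(** Riesz-Fischer. The limit is written as an upper limit, so it is measurable everywhere although
    the subsequence converges only almost everywhere; Fatou's lemma then gives convergence of the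
    whole sequence. *)
Lemma sqint_complete (s : nat -> T -> R) : (forall k, mfun (s k)) ->
  (forall e : R, 0 < e -> exists N, forall k l, (N <= k)%N -> (N <= l)%N ->
     (sqint (fun x => s k x - s l x)%R <= e%:E)%E) ->
  exists phi : nat -> nat,
    let f x := fine (limn_esup (fun j => (s (phi j) x)%:E)) in
    mfun f /\ (fun k => sqint (fun x => f x - s k x)) @ \oo --> 0%E.
Proof.
move=> ms cs.
have /choice[N NP] : forall j, exists N, forall k l, (N <= k)%N -> (N <= l)%N ->
    (sqint (fun x => s k x - s l x)%R <= (q j ^+ 3)%:E)%E.
  by move=> j; apply: cs; rewrite !exprn_gt0.
(* Summing the N i makes phi nondecreasing and at least N j; the summand j makes phi j >= j. *)
pose phi j := (\sum_(i < j.+1) N i + j)%N.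
have Nphi j : (N j <= phi j)%N by rewrite /phi big_ord_recr/= -addnA addnCA leq_addr.
have phiS j : (phi j <= phi j.+1)%N.
  by rewrite /phi [leqRHS]addnS ltnW// ltnS [in leqRHS]big_ord_recr/= leq_add2r leq_addr.
exists phi => f.
have mf : mfun f.
  apply: measurableT_comp; first exact: fine_measurable.
  by apply: measurable_fun_limn_esup => j; exact/measurable_EFinP.
split=> //.
have scvg : {ae mu, forall x, (fun j => s (phi j) x) @ \oo --> f x}.
  have : {ae mu, forall x, exists C : R, forall j,
      `|s (phi j.+1) x - s (phi j) x| <= C * q j}.
    apply: (@ae_geometric_bound (fun j x => s (phi j.+1) x - s (phi j) x)) => j.
      exact: measurable_funB.
    by apply: NP => //; exact: leq_trans (phiS j).
  apply: filterS => x [C sC]; pose u j := s (phi j) x.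
  suff ucvg : cvgn u.
    suff -> : f x = limn u by [].
    have : (EFin \o u) @ \oo --> (limn u)%:E.
      by apply: cvg_EFin => //; exact: nearW.
    by rewrite /f => /cvg_limn_einf_sup[_ /= ->].
  have : cvgn (series (telescope u)).
    apply: normed_cvg; apply: (@series_le_cvg _ _ (geometric (C / 2) 2^-1)) => //.
    - by move=> n; rewrite normr_ge0.
    - move=> n; have := le_trans (normr_ge0 _) (sC n).
      by rewrite exprS mulrA.
    - by move=> n; have := sC n; rewrite exprS mulrA.
    - by apply: is_cvg_geometric_series; rewrite ger0_norm// invf_lt1// ltr1n.
  move=> ucvg; have -> : u = (fun j => u 0%N + series (telescope u) j).
    by apply/funext => j; rewrite -eq_sum_telescope.
  by apply: is_cvgD => //; exact: is_cvg_cst.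
apply/cvge0P => [k|e e0]; first exact: sqint_ge0.
have [K KP] := cs e e0; exists K => k Kk.
(* For fixed k, |f - s k|^2 is almost everywhere the limit of |s (phi j) - s k|^2, whose integrals
   are at most e once j >= K. *)
have lim_le : (limn_einf (fun j => sqint (fun x => s (phi j) x - s k x)%R) <= e%:E)%E.
  apply: (@limn_einf_le _ _ K) => j Kj; apply: KP => //.
  by rewrite (leq_trans Kj)// leq_addl.
apply: le_trans lim_le; apply: le_trans (fatou _ _ _ _) => //; last 2 first.
- by move=> j; apply: measurable_sqr; exact: measurable_funB.
- by move=> j x _; rewrite lee_fin sqr_ge0.
apply: ae_ge0_le_integral => //.
- by move=> x _; rewrite lee_fin sqr_ge0.
- by apply: measurable_sqr; exact: measurable_funB.
- move=> x _; rewrite limn_einf_lim; apply: lime_ge; first exact: is_cvg_einfs.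
  apply: nearW => n; apply: le_ereal_inf_tmp => _ [j _ <-].
  by rewrite lee_fin sqr_ge0.
- rewrite /limn_einf; apply: measurableT_comp => //.
  apply: measurable_fun_limn_esup => j; apply: measurableT_comp => //.
  by apply: measurable_sqr; exact: measurable_funB.
apply: filterS scvg => x sx _; rewrite le_eqVlt; apply/orP; left; apply/eqP.
have : (fun j => ((s (phi j) x - s k x) ^+ 2)%:E) @ \oo --> ((f x - s k x) ^+ 2)%:E.
  apply: cvg_EFin; first by apply: nearW.
  apply: (@continuous_cvg _ _ _ \oo _ (fun j => s (phi j) x - s k x) (fun y => y ^+ 2)).
    exact: exprn_continuous.
  by apply: cvgB => //; exact: cvg_cst.
by move=> /cvg_limn_einf_sup[-> _].
Qed.

(** The weighted inequality is used in both directions, for s k = f - h and for f = s k + h. *)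
Lemma cvg_sqint f (s : nat -> T -> R) : mfun f -> (forall k, mfun (s k)) ->
  (sqint f < +oo)%E ->
  (fun k => sqint (fun x => f x - s k x)) @ \oo --> 0%E ->
  (fun k => sqint (s k)) @ \oo --> sqint f.
Proof.
move=> mf ms foo fs; pose F := fine (sqint f).
have FE : sqint f = F%:E by rewrite fineK// ge0_fin_numE// sqint_ge0.
have F0 : 0 <= F by rewrite fine_ge0// sqint_ge0.
rewrite FE.
(* The squared error is taken below e^2, so that (1 + 1/e) times it is at most e^2 + e. As e <= 1,
   this gives S <= 2 F + 2 and then the stated bound, whose constants are generous. *)
have main e : 0 < e -> e <= 1 -> exists N, forall k, (N <= k)%N ->
    exists S : R, sqint (s k) = S%:E /\ `|F - S| <= e * (3 * F + 10).
  move=> e0 e1; have e20 : 0 < e ^+ 2 by rewrite exprn_gt0.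
  have [N NP] := (cvge0P (fun k => sqint_ge0 mu _)).1 fs _ e20.
  exists N => k /NP; set h := (fun x => f x - s k x).
  have mh : mfun h by exact: measurable_funB.
  have h0 := sqint_ge0 mu h.
  move=> hle; have [Hk HE] : exists Hk, sqint h = Hk%:E.
    by exists (fine (sqint h)); rewrite fineK// ge0_fin_numE// (le_lt_trans hle)// ltry.
  move: hle h0; rewrite HE !lee_fin => hle h0.
  have s1 : (sqint (s k) <= (1 + e)%:E * sqint f + (1 + e^-1)%:E * sqint h)%E.
    rewrite -(sqintN mu h) (_ : s k = fun x => f x + (- h x)).
      by apply: sqintD_le_weighted => //; exact: measurableT_comp.
    by apply/funext => x; rewrite /h; ring.
  have s2 : (sqint f <= (1 + e)%:E * sqint (s k) + (1 + e^-1)%:E * sqint h)%E.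
    rewrite (_ : f = fun x => s k x + h x); first exact: sqintD_le_weighted.
    by apply/funext => x; rewrite /h; ring.
  have s0 := sqint_ge0 mu (s k).
  have soo : sqint (s k) \is a fin_num.
    rewrite ge0_fin_numE// (le_lt_trans s1)// FE HE -!EFinM -EFinD.
    exact: ltry.
  exists (fine (sqint (s k))); rewrite fineK//; split => //.
  move: s0 s1 s2; rewrite -(fineK soo) FE HE -!EFinM -!EFinD !lee_fin.
  move: (fine _) => S S0 s1 s2.
  have eH : e^-1 * Hk <= e.
    by rewrite mulrC ler_pdivrMr// -expr2.
  have ee : e ^+ 2 <= e by rewrite expr2 ler_piMl// ltW.
  have eF : e * F <= F by rewrite ler_piMl.
  rewrite !mulrDl !mul1r in s1 s2.
  have S1 : S <= 2 * F + 2 by lra.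
  have eS : e * S <= e * (2 * F + 2) by rewrite ler_wpM2l// ltW.
  have eF0 : 0 <= e * F by rewrite mulr_ge0// ltW.
  by rewrite /= ler_norml; apply/andP; split; nra.
apply/fine_cvgP; split.
  have [N NP] := main 1 ltr01 (lexx _).
  by exists N => // k /= /NP[S [-> _]].
apply/cvgrPdist_le => e e0.
have d0 : 0 < 3 * F + 10 by nra.
have m0 : 0 < Num.min 1 (e / (3 * F + 10)) by rewrite lt_min ltr01 divr_gt0.
have m1 : Num.min 1 (e / (3 * F + 10)) <= 1 by rewrite ge_min lexx.
have [N NP] := main _ m0 m1.
exists N => // k /= /NP[S [-> /= FS]]; apply: le_trans FS _.
by rewrite -ler_pdivlMr// ge_min lexx orbT.
Qed.

End square_integral_limits.

(** * Normal laws *)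

Section image_measures.
Context {R : realType} d d' {T : measurableType d} {T' : measurableType d'}.

Definition image_measure (m : {measure set T -> \bar R}) (f : T -> T')
    (mf : measurable_fun [set: T] f) : {measure set T' -> \bar R} :=
  measure_function_pushforward__canonical__measure_function_Measure m mf.

Definition law (P : probability T R) (f : T -> T')
    (mf : measurable_fun [set: T] f) : probability T' R :=
  distribution P (HB.pack_for {mfun T >-> T'} f (isMeasurableFun.Build _ _ _ _ f mf)).

Lemma ge0_integral_image (m : {measure set T -> \bar R}) (f : T -> T')
    (mf : measurable_fun [set: T] f) (D : set T')
    (g : T' -> \bar R) : measurable D -> measurable_fun [set: T'] g ->
  (forall y, 0 <= g y)%E ->
  (\int[image_measure m mf]_(y in D) g y = \int[m]_(x in f @^-1` D) g (f x))%E.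
Proof.
move=> mD mg g0; apply: ge0_integral_pushforward => //.
exact: measurable_funS mg.
Qed.

Lemma ge0_integral_law (P : probability T R) (f : T -> T')
    (mf : measurable_fun [set: T] f) (D : set T') (g : T' -> \bar R) : measurable D -> measurable_fun [set: T'] g ->
  (forall y, 0 <= g y)%E ->
  (\int[law P mf]_(y in D) g y = \int[P]_(x in f @^-1` D) g (f x))%E.
Proof. exact: (@ge0_integral_image P). Qed.

Lemma integral_law (P : probability T R) (f : T -> T')
    (mf : measurable_fun [set: T] f) (g : T' -> \bar R) :
  measurable_fun [set: T'] g -> P.-integrable setT (g \o f) ->
  (\int[law P mf]_y g y = \int[P]_x g (f x))%E.
Proof. by move=> mg ig; apply: (integral_pushforward mf mg ig). Qed.

End image_measures.

(** * Affine change of variables for Lebesgue measure and normal laws *)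

Section affine_images_of_normal_laws.
Context {R : realType}.
Local Notation leb := (@lebesgue_measure R).

Lemma measurable_affine (a b : R) : measurable_fun [set: R] (fun x => a * x + b).
Proof. by apply: measurable_funD => //; exact: measurable_funM. Qed.

(** The right side is a measure in A, so it suffices to compare on intervals ]c, d]; for a < 0 their
    preimages are closed at the other end, hence the two cases. *)
Lemma lebesgue_measure_affine (a b : R) (A : set R) : a != 0 -> measurable A ->
  leb A = (`|a|%:E * leb ((fun x => a * x + b)%R @^-1` A))%E.
Proof.
move=> a0 mA; have na0 : 0 <= `|a| by [].
have mf : measurable_fun [set: R] ((fun x => a * x + b) : R -> measurableTypeR R).
  exact: measurable_affine.
pose mu' := mscale (NngNum na0) (image_measure leb mf).
suff : leb A = mu' A by [].
apply: lebesgue_measure_unique => // _ [[c d] _ <-] /=.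
rewrite /mu' /mscale/= /image_measure/= /pushforward lebesgue_measure_itv/=.
have [agt0|alt0|aeq0] := ltgtP a 0; last by rewrite aeq0 eqxx in a0.
- rewrite (_ : _ @^-1` _ = `[(d - b) / a, (c - b) / a[%classic); last first.
    apply/seteqP; split => x /=; rewrite !in_itv/= => /andP[h1 h2]; apply/andP; split.
    + by rewrite ler_ndivrMr// mulrC; lra.
    + by rewrite ltr_ndivlMr// mulrC; lra.
    + by move: h2; rewrite ltr_ndivlMr// mulrC; lra.
    + by move: h1; rewrite ler_ndivrMr// mulrC; lra.
  rewrite lebesgue_measure_itv/= !lte_fin ltr_ndivrMr// divfK//.
  rewrite ltrD2r; case: ifPn => _; last by rewrite mule0.
  rewrite -!EFinD -EFinM ltr0_norm//; congr EFin; field; exact: a0.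
- rewrite (_ : _ @^-1` _ = `](c - b) / a, (d - b) / a]%classic); last first.
    apply/seteqP; split => x /=; rewrite !in_itv/= => /andP[h1 h2]; apply/andP; split.
    + by rewrite ltr_pdivrMr// mulrC; lra.
    + by rewrite ler_pdivlMr// mulrC; lra.
    + by move: h1; rewrite ltr_pdivrMr// mulrC; lra.
    + by move: h2; rewrite ler_pdivlMr// mulrC; lra.
  rewrite lebesgue_measure_itv/= !lte_fin ltr_pdivrMr// divfK//.
  rewrite ltrD2r; case: ifPn => _; last by rewrite mule0.
  rewrite -!EFinD -EFinM gtr0_norm//; congr EFin; field; exact: a0.
Qed.

Lemma ge0_integral_affine (a b : R) (f : R -> \bar R) (A : set R) :
  a != 0 -> measurable A -> measurable_fun [set: R] f -> (forall x, 0 <= f x)%E ->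
  (\int[leb]_(y in A) f y
   = `|a|%:E * \int[leb]_(x in (fun x => (a * x + b)%R) @^-1` A) f (a * x + b)%R)%E.
Proof.
move=> a0 mA mf f0; have na0 : 0 <= `|a| by [].
have mg : measurable_fun [set: R] ((fun x => a * x + b) : R -> measurableTypeR R).
  exact: measurable_affine.
transitivity (\int[mscale (NngNum na0) (image_measure leb mg)]_(y in A) f y)%E.
  apply: eq_measure_integral => // B mB _.
  exact: (lebesgue_measure_affine b a0 mB).
rewrite ge0_integral_mscale//=; last exact: measurable_funS mf.
by congr (_ * _)%E; rewrite ge0_integral_image.
Qed.

(** A negative s is allowed, as the density depends on s^2 only; s = -1 yields the symmetry
    [normal_prob_opp]. *)
Lemma normal_prob_affine (m s : R) (A : set R) : s != 0 -> measurable A ->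
  normal_prob m s A = normal_prob 0 1 ((fun x => s * x + m) @^-1` A).
Proof.
move=> s0 mA; rewrite /normal_prob (@ge0_integral_affine s m)//; last 2 first.
- by apply/measurable_EFinP; exact: measurable_normal_pdf.
- by move=> x; rewrite lee_fin normal_pdf_ge0.
rewrite -ge0_integralZl_EFin//=; last 3 first.
- by rewrite -[X in measurable X]setTI; exact: measurable_affine.
- by move=> x _; rewrite lee_fin normal_pdf_ge0.
- apply/measurable_EFinP/measurable_funTS; apply: measurableT_comp.
    exact: measurable_normal_pdf.
  exact: measurable_affine.
apply: eq_integral => x _; rewrite -EFinM !normal_pdfE//; congr EFin.
rewrite /normal_peak /normal_fun mulrA; congr (_ * _).
  rewrite -mulrnAr sqrtrM ?sqr_ge0// sqrtr_sqr invfM mulrA mulfV ?normr_eq0//.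
  by rewrite mul1r expr1n mul1r.
congr expR; rewrite addrK subr0 expr1n; field; exact: s0.
Qed.

(** One formula for point masses and proper normal laws, which spares later arguments the case v =
    0. *)
Lemma gaussian_law_affine (m v : R) (A : set R) : 0 <= v -> measurable A ->
  gaussian_law m v A = normal_prob 0 1 ((fun x => Num.sqrt v * x + m) @^-1` A).
Proof.
move=> v0 mA; rewrite /gaussian_law; case: eqVneq => [->|vn0]; last first.
  by apply: normal_prob_affine => //; rewrite sqrtr_eq0 -ltNge lt_neqAle eq_sym vn0.
rewrite sqrtr0 diracE; case: (boolP (m \in A)) => mAb.
  rewrite (_ : _ @^-1` _ = setT) ?probability_setT//.
  by apply/seteqP; split => // x _ /=; rewrite mul0r add0r; exact/set_mem.
rewrite (_ : _ @^-1` _ = set0) ?measure0//.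
apply/seteqP; split => // x /=; rewrite mul0r add0r => /mem_set.
by rewrite (negbTE mAb).
Qed.

End affine_images_of_normal_laws.

(** * Convolution of normal laws *)

Section normal_laws.
Context {R : realType}.
Local Notation leb := (@lebesgue_measure R).
Local Notation nrm := (@normal_prob R).

(** The Radon-Nikodym derivative of the normal law and its density have equal integrals over all
    measurable sets, hence agree almost everywhere. *)
Lemma ge0_integral_normal_prob (m s : R) (f : R -> \bar R) :
  (forall x, 0 <= f x)%E -> measurable_fun [set: R] f ->
  (\int[nrm m s]_x f x = \int[leb]_x (f x * (normal_pdf m s x)%:E))%E.
Proof.
move=> f0 mf; have dom := normal_prob_dominates m s.
have mpdf : measurable_fun [set: R] (fun x => (normal_pdf m s x)%:E).
  by apply/measurable_EFinP; exact: measurable_normal_pdf.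
have rni := Radon_Nikodym_SigmaFinite.f_integrable dom.
rewrite -(Radon_Nikodym_SigmaFinite.change_of_variables dom)//.
apply: ge0_ae_eq_integral => //.
- by apply: emeasurable_funM => //; exact: measurable_int rni.
- exact: emeasurable_funM.
- by move=> x _; rewrite mule_ge0//; exact: Radon_Nikodym_SigmaFinite.f_ge0.
- by move=> x _; rewrite mule_ge0// lee_fin normal_pdf_ge0.
apply: ae_eqe_mul2l => /=; apply: integral_ae_eq => // E _ mE.
by rewrite -Radon_Nikodym_SigmaFinite.f_integral.
Qed.

(** Completing the square in x: the joint density of a summand x and the sum z is the density of z
    times the conditional density of x given z, which is normal with mean z s1^2/s^2 and deviation
    s1 s2/s. *)
Lemma normal_pdf_mul_conv (s1 s2 x z : R) : s1 != 0 -> s2 != 0 ->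
  let s := Num.sqrt (s1 ^+ 2 + s2 ^+ 2) in
  normal_pdf 0 s1 x * normal_pdf 0 s2 (z - x)
  = normal_pdf 0 s z * normal_pdf (z * s1 ^+ 2 / s ^+ 2) (s1 * s2 / s) x.
Proof.
move=> s10 s20 s.
have ss : s ^+ 2 = s1 ^+ 2 + s2 ^+ 2 by rewrite sqr_sqrtr// addr_ge0// sqr_ge0.
have s0 : s != 0.
  by rewrite sqrtr_eq0 -ltNge ltr_pwDl ?sqr_ge0// lt_def sqr_ge0 sqrf_eq0 s10.
rewrite !normal_pdfE ?mulf_neq0 ?invr_eq0//.
rewrite mulrACA [RHS]mulrACA; congr (_ * _).
  rewrite /normal_peak -!invfM -!sqrtrM//; last 2 first.
  - by rewrite mulrn_wge0// mulr_ge0 ?sqr_ge0 ?pi_ge0.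
  - by rewrite mulrn_wge0// mulr_ge0 ?sqr_ge0 ?pi_ge0.
  by congr (Num.sqrt _)^-1; field.
rewrite /normal_fun -!expRD; congr expR.
have s120 : s1 ^+ 2 + s2 ^+ 2 != 0 by rewrite -ss sqrf_eq0.
rewrite expr_div_n ss; field.
by rewrite s10 s20 s120.
Qed.

(** After exchanging the integrals, the factorisation above leaves a normal density in x, of
    integral 1, times the density of the sum. *)
Lemma normal_prob_conv (s1 s2 : R) (A : set R) : s1 != 0 -> s2 != 0 ->
  measurable A ->
  (\int[nrm 0 s1]_x nrm 0 s2 [set y | A (x + y)%R]
   = nrm 0 (Num.sqrt (s1 ^+ 2 + s2 ^+ 2)) A)%E.
Proof.
move=> s10 s20 mA; set s := Num.sqrt _.
have mpdf m t : measurable_fun [set: R] (@normal_pdf R m t) by exact: measurable_normal_pdf.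
pose F (p : R * R) : \bar R :=
  (normal_pdf 0 s1 p.1 * normal_pdf 0 s2 (p.2 - p.1) * \1_A p.2)%:E.
have F0 p : (0 <= F p)%E by rewrite lee_fin !mulr_ge0 ?normal_pdf_ge0// indicE.
have mF : measurable_fun [set: R * R] F.
  apply/measurable_EFinP; apply: measurable_funM.
    apply: measurable_funM; first exact: (measurableT_comp (mpdf _ _)).
    by apply: (measurableT_comp (mpdf _ _)); exact: measurable_funB.
  exact: (measurableT_comp (measurable_indic mA)).
have shift x : nrm 0 s2 [set y | A (x + y)] =
    (\int[leb]_z (normal_pdf 0 s2 (z - x) * \1_A z)%:E)%E.
  transitivity (\int[leb]_(z in A) (normal_pdf 0 s2 (z - x)%R)%:E)%E.
    rewrite (@ge0_integral_affine _ 1 x)//; last 2 first.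
    - apply/measurable_EFinP; apply: (measurableT_comp (mpdf _ _)).
      exact: measurable_funB.
    - by move=> z; rewrite lee_fin normal_pdf_ge0.
    rewrite normr1 mul1e /normal_prob.
    rewrite (_ : [set y | _] = (fun z => 1 * z + x) @^-1` A); last first.
      by apply/seteqP; split => y /=; rewrite mul1r addrC.
    by apply: eq_integral => y _; rewrite mul1r addrK.
  rewrite integral_mkcond; apply: eq_integral => z _.
  by rewrite patchE indicE; case: (z \in A); rewrite ?mulr1 ?mulr0.
transitivity (\int[leb]_x \int[leb]_z F (x, z))%E.
  rewrite ge0_integral_normal_prob//.
    apply: eq_integral => x _; rewrite shift muleC -ge0_integralZl_EFin//.
    - by apply: eq_integral => z _; rewrite -EFinM mulrA.
    - by move=> z _; rewrite lee_fin mulr_ge0 ?normal_pdf_ge0// indicE.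
    - apply/measurable_EFinP; apply: measurable_funM => //.
      by apply: (measurableT_comp (mpdf _ _)); exact: measurable_funB.
    - exact: normal_pdf_ge0.
  rewrite (funext shift).
  apply: (@measurable_fun_fubini_tonelli_F _ _ _ _ _ leb
    (fun p : R * R => (normal_pdf 0 s2 (p.2 - p.1) * \1_A p.2)%:E)).
  - apply/measurable_EFinP; apply: measurable_funM.
      by apply: (measurableT_comp (mpdf _ _)); exact: measurable_funB.
    exact: (measurableT_comp (measurable_indic mA)).
  - by move=> p; rewrite lee_fin mulr_ge0 ?normal_pdf_ge0// indicE.
transitivity (\int[leb]_z \int[leb]_x F (x, z))%E.
  exact: (@fubini_tonelli _ _ _ _ _ leb leb).
rewrite /normal_prob [RHS]integral_mkcond.
apply: eq_integral => z _; rewrite patchE -/s.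
transitivity (\int[leb]_x ((normal_pdf 0 s z * \1_A z)%:E *
    (normal_pdf (z * s1 ^+ 2 / s ^+ 2) (s1 * s2 / s) x)%:E))%E.
  apply: eq_integral => x _; rewrite /F/= normal_pdf_mul_conv// -EFinM.
  by congr EFin; rewrite mulrAC.
rewrite ge0_integralZl_EFin//.
- rewrite integral_normal_pdf mule1 indicE.
  by case: (z \in A); rewrite ?mulr1 ?mulr0.
- by move=> x _; rewrite lee_fin normal_pdf_ge0.
- by apply/measurable_EFinP; exact: mpdf.
- by rewrite mulr_ge0 ?normal_pdf_ge0// indicE.
Qed.

End normal_laws.

(** * The variance of the standard normal law *)

Section normal_moments.
Context {R : realType}.
Local Notation leb := (@lebesgue_measure R).
Local Notation p := (@normal_pdf R 0 1).

(** As r decreases to 1 the bounds become m <= 1 and 1 <= m. They are what the comparison in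
    [normal_second_moment] yields after clearing denominators. *)
Lemma sqr_moment_squeeze (m : R) :
  (forall r, 1 < r -> m * (r + 1) <= 2 * r ^+ 2 /\ 2 <= m * r * (r + 1)) -> m = 1.
Proof.
move=> mr; apply/eqP; rewrite eq_le; apply/andP; split; apply/ler_addgt0Pr => e e0.
- pose d := Num.min 1 (e / 3).
  have [d0 d1 d3] : [/\ 0 < d, d <= 1 & d <= e / 3].
    by rewrite lt_min ltr01 divr_gt0// !ge_min !lexx orbT.
  have [|h _] := mr (1 + d); first by rewrite ltrDl.
  by rewrite leNgt; apply/negP => me; nra.
- have [e1|e1] := leP 1 e.
    have [|_] := mr 2; first by rewrite ltr1n.
    by nra.
  have [|_ h] := mr (1 + e / 2); first by rewrite ltrDl divr_gt0.
  by rewrite leNgt; apply/negP => me; nra.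
Qed.

(* With [w = (r^2 - 1) x^2 / 2] and [p (r x) = p x * exp (- w)], integrate
   [p (r x) (1 + w) <= p x <= p (r x) + w p x]; scaling expresses every term
   through the second moment, and [r] tends to [1]. *)
Lemma normal_second_moment : (\int[normal_prob (0 : R) 1]_x (x ^+ 2)%:E = 1)%E.
Proof.
have mp : measurable_fun [set: R] p by exact: measurable_normal_pdf.
have p0 x : 0 <= p x by exact: normal_pdf_ge0.
have mpr (r : R) : measurable_fun [set: R] (fun x => p (r * x)).
  by apply: (measurableT_comp mp); exact: measurable_funM.
have msq : measurable_fun [set: R] (fun x : R => x ^+ 2) by exact: measurable_funX.
rewrite ge0_integral_normal_prob//; last 2 first.
- by move=> x; rewrite lee_fin sqr_ge0.
- exact/measurable_EFinP.
set M := (\int[leb]_x _)%E.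
have M0 : (0 <= M)%E.
  by apply: integral_ge0 => x _; rewrite mule_ge0 ?lee_fin ?sqr_ge0.
have scale (r : R) (g : R -> R) : 0 < r -> measurable_fun [set: R] g ->
    (forall x, 0 <= g x) ->
    (\int[leb]_x (g x)%:E = r%:E * \int[leb]_x (g (r * x))%R%:E)%E.
  move=> r0 mg g0; rewrite (@ge0_integral_affine _ r 0 (fun x => (g x)%:E) setT)//.
  - by rewrite gtr0_norm//; congr (_ * _)%E; apply: eq_integral => x _; rewrite addr0.
  - by rewrite gt_eqF.
  - exact/measurable_EFinP.
have K1 (r : R) : 0 < r -> (\int[leb]_x (p (r * x))%:E = r^-1%:E)%E.
  move=> r0; have := scale r p r0 mp p0; rewrite integral_normal_pdf.
  move=> /(congr1 (fun z => r^-1%:E * z)%E); rewrite mule1 muleA -EFinM.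
  by rewrite mulVf ?gt_eqF// mul1e => <-.
have K2 (r : R) : 0 < r ->
    (M = (r ^+ 3)%:E * \int[leb]_x (x ^+ 2 * p (r * x))%R%:E)%E.
  move=> r0; rewrite /M; under eq_integral do rewrite -EFinM.
  rewrite (scale r (fun x => x ^+ 2 * p x))//; last 2 first.
  - exact: measurable_funM.
  - by move=> x; rewrite mulr_ge0 ?sqr_ge0.
  rewrite exprS EFinM -muleA; congr (_ * _)%E.
  rewrite -ge0_integralZl_EFin ?sqr_ge0//.
  - by apply: eq_integral => x _; rewrite -EFinM; congr EFin; ring.
  - by move=> x _; rewrite lee_fin mulr_ge0 ?sqr_ge0.
  - by apply/measurable_EFinP; exact: (measurable_funM msq (mpr r)).
have Kexp (r x : R) : p (r * x) = p x * expR (- ((r ^+ 2 - 1) / 2 * x ^+ 2)).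
  rewrite normal_pdfE ?oner_eq0// /normal_fun/= -[RHS]mulrA -expRD; congr (_ * expR _).
  by rewrite !subr0 expr1n; field.
have c0 (r : R) : 1 < r -> 0 <= (r ^+ 2 - 1) / 2.
  by move=> r1; rewrite divr_ge0// subr_ge0 exprn_ege1// ltW.
pose L r := (\int[leb]_x (x ^+ 2 * p (r * x))%R%:E)%E.
have mL (r : R) : measurable_fun [set: R] (fun x => (x ^+ 2 * p (r * x))%:E).
  by apply/measurable_EFinP; exact: (measurable_funM msq (mpr r)).
have L0 r : (0 <= L r)%E.
  by apply: integral_ge0 => x _; rewrite lee_fin mulr_ge0 ?sqr_ge0.
have cp0 (r x y : R) : 1 < r -> 0 <= (r ^+ 2 - 1) / 2 * (x ^+ 2 * p y).
  by move=> r1; apply: mulr_ge0; [exact: c0|rewrite mulr_ge0 ?sqr_ge0].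
have mpE : measurable_fun [set: R] (fun x => (p x)%:E) by exact/measurable_EFinP.
have mprE (r : R) : measurable_fun [set: R] (fun x => (p (r * x))%:E).
  exact/measurable_EFinP.
have mM : measurable_fun [set: R] (fun x => (x ^+ 2)%:E * (p x)%:E)%E.
  by apply: emeasurable_funM => //; exact/measurable_EFinP.
have mcst (c : R) (f : R -> \bar R) : measurable_fun [set: R] f ->
    measurable_fun [set: R] (fun x => c%:E * f x)%E.
  by move=> mf; exact: emeasurable_funM.
have I1 (r : R) : 1 < r -> (r^-1%:E + ((r ^+ 2 - 1) / 2)%:E * L r <= 1)%E.
  move=> r1; rewrite -K1 ?(lt_trans _ r1)// -ge0_integralZl_EFin//; last 3 first.
  - by move=> x _; rewrite lee_fin mulr_ge0 ?sqr_ge0.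
  - exact: mL.
  - exact: c0.
  rewrite -ge0_integralD//; last 4 first.
  - by move=> x _; rewrite lee_fin.
  - exact: mprE.
  - by move=> x _; rewrite -EFinM lee_fin cp0.
  - exact: (mcst _ _ (mL r)).
  rewrite -(integral_normal_pdf (0 : R) 1); apply: ge0_le_integral => //.
  - by move=> x _; rewrite -EFinM -EFinD lee_fin addr_ge0// cp0.
  - by apply: emeasurable_funD; [exact: mprE|exact: (mcst _ _ (mL r))].
  move=> x _; rewrite -EFinM -EFinD lee_fin Kexp.
  set w := _ / 2 * x ^+ 2; rewrite -subr_ge0.
  have -> : p x - (p x * expR (- w) + (r ^+ 2 - 1) / 2 * (x ^+ 2 * (p x * expR (- w))))
    = p x * (1 - expR (- w) * (1 + w)) by rewrite /w; ring.
  rewrite mulr_ge0// subr_ge0 expRN [leLHS]mulrC ler_pdivrMr ?expR_gt0// mul1r.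
  exact: expR_ge1Dx.
have I2 (r : R) : 1 < r -> (1 <= r^-1%:E + ((r ^+ 2 - 1) / 2)%:E * M)%E.
  move=> r1; rewrite -K1 ?(lt_trans _ r1)// -ge0_integralZl_EFin//; last 2 first.
  - by move=> x _; rewrite -EFinM lee_fin mulr_ge0 ?sqr_ge0.
  - exact: c0.
  rewrite -ge0_integralD//; last 4 first.
  - by move=> x _; rewrite lee_fin.
  - exact: mprE.
  - by move=> x _; rewrite -!EFinM lee_fin cp0.
  - exact: (mcst _ _ mM).
  rewrite -[leLHS](integral_normal_pdf (0 : R) 1); apply: ge0_le_integral => //.
  - by move=> x _; rewrite lee_fin.
  - by apply: emeasurable_funD; [exact: mprE|exact: (mcst _ _ mM)].
  move=> x _; rewrite -!EFinM -EFinD lee_fin Kexp.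
  set w := _ / 2 * x ^+ 2; rewrite -subr_ge0.
  have -> : p x * expR (- w) + (r ^+ 2 - 1) / 2 * (x ^+ 2 * p x) - p x
    = p x * (expR (- w) - (1 + - w)) by rewrite /w; ring.
  by rewrite mulr_ge0// subr_ge0; exact: expR_ge1Dx.
(* Finiteness of the second moment is not known beforehand: [I1] bounds [L r] because its
   coefficient is positive, and scaling with r = 2 transfers this to [M]. *)
have Lfin (r : R) : 1 < r -> L r \is a fin_num.
  move=> r1; have := I1 _ r1; rewrite ge0_fin_numE//.
  case: (L r) (L0 r) => [l| |]// _; first by rewrite ltry.
  rewrite gt0_muley ?addey// ?leye_eq//.
  by rewrite lte_fin divr_gt0// subr_gt0 exprn_egt1.
have Mfin : M \is a fin_num.
  have h2 : (1 : R) < 2 by rewrite ltr1n.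
  by rewrite (K2 2)// -/(L 2) -(fineK (Lfin 2 h2)) -EFinM.
rewrite -(fineK Mfin); congr EFin; apply: sqr_moment_squeeze => r r1.
have r0 : 0 < r by exact: lt_trans r1.
have r_neq0 : r != 0 by rewrite gt_eqF.
have := I1 _ r1; have := I2 _ r1; have := K2 _ r0.
rewrite -/(L r) -(fineK (Lfin _ r1)) -(fineK Mfin) -!EFinM -!EFinD !lee_fin => -[].
move: (fine M) (fine (L r)) => m l -> i2 i1; split.
- have rm : 0 < r - 1 by rewrite subr_gt0.
  rewrite -(ler_pM2r rm).
  have -> : r ^+ 3 * l * (r + 1) * (r - 1) = 2 * r ^+ 3 * ((r ^+ 2 - 1) / 2 * l).
    by field.
  have -> : 2 * r ^+ 2 * (r - 1) = 2 * r ^+ 3 * (1 - r^-1) by field.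
  rewrite ler_wpM2l//; first by rewrite mulr_ge0// exprn_ge0// ltW.
  by rewrite lerBrDl.
- have : r * 1 <= r * (r^-1 + (r ^+ 2 - 1) / 2 * (r ^+ 3 * l)) by rewrite ler_pM2l.
  rewrite mulrDr mulfV// mulr1.
  move: (r ^+ 3 * l) => m' i3; have rm : 0 < r - 1 by rewrite subr_gt0.
  rewrite -(ler_pM2l rm).
  have -> : (r - 1) * (m' * r * (r + 1)) = 2 * (r * ((r ^+ 2 - 1) / 2 * m')) by field.
  by lra.
Qed.

End normal_moments.

(** * Laws on the line are determined by continuous test functions *)

Section laws_on_the_line.
Context {R : realType}.

(** Continuous approximation from below of the indicator of ]-oo, a[; the ray is open because the
    value at a is 0 for every m. *)
Definition ramp (a : R) (m : nat) (y : R) : R :=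
  Num.min 1 (Num.max 0 (m%:R * (a - y))).

Lemma ramp_ge0_le1 a m y : 0 <= ramp a m y <= 1.
Proof. by rewrite /ramp le_min ler01 le_max lexx/= ge_min lexx. Qed.

Lemma continuous_ramp a m : continuous (ramp a m).
Proof.
move=> y; apply: (@continuous_min R R (cst 1) (fun y => Num.max 0 (m%:R * (a - y))));
  first exact: cvg_cst.
apply: (@continuous_max R R (cst 0) (fun y => m%:R * (a - y))); first exact: cvg_cst.
by apply: cvgM; [exact: cvg_cst|apply: cvgB; [exact: cvg_cst|exact: cvg_id]].
Qed.

Lemma cvg_ramp a y : ramp a ^~ y @ \oo --> (\1_(`]-oo, a[%classic) y : R).
Proof.
rewrite indicE; have [ya|ay] := ltP y a.
  rewrite mem_set/= ?in_itv//=; have [N NP] : exists N : nat, 1 / (a - y) <= N%:R.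
    by exists (Num.truncn (1 / (a - y))).+1; rewrite ltW// real_truncnS_gt// num_real.
  apply: cvg_near_cst; exists N => // m /= Nm; rewrite /ramp.
  have ay : 0 < a - y by rewrite subr_gt0.
  have : 1 <= m%:R * (a - y).
    by rewrite -ler_pdivrMr// (le_trans NP)// ler_nat.
  by move=> h; have /max_idPr -> := le_trans ler01 h; apply/min_idPl.
rewrite memNset/= ?in_itv/=; last by apply/negP; rewrite -leNgt.
apply: cvg_near_cst; apply: nearW => m.
have /max_idPl max0 : m%:R * (a - y) <= 0 by rewrite mulr_ge0_le0// subr_le0.
by rewrite /ramp max0; apply/min_idPr.
Qed.

Lemma dominated_convergence_le1 d (T : measurableType d) (mu : probability T R)
    (f_ : nat -> T -> R) (f : T -> R) :
  (forall n, measurable_fun setT (f_ n)) -> measurable_fun setT f ->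
  (forall n x, 0 <= f_ n x <= 1) ->
  {ae mu, forall x, f_ ^~ x @ \oo --> f x} ->
  (fun n => \int[mu]_x (f_ n x)%:E)%E @ \oo --> (\int[mu]_x (f x)%:E)%E.
Proof.
move=> mf_ mf f01 ff.
have [] := @dominated_convergence _ T R mu setT measurableT
  (fun n x => (f_ n x)%:E) (fun x => (f x)%:E) (cst 1%E) _ _ _ _ _ => //.
- by move=> n; exact/measurable_EFinP.
- exact/measurable_EFinP.
- by apply: filterS ff => x fx _; apply: cvg_EFin => //; exact: nearW.
- by apply: finite_measure_integrable_cst.
- apply/aeW => x n _; rewrite lee_fin ger0_norm; by case/andP: (f01 n x).
Qed.

(** Ramps recover the measure of every open ray, and these rays form a generating class closed under
    intersection. *)
Lemma eq_probability_continuous (mu nu : probability R R) :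
  (forall g : R -> R, continuous g -> (forall x, 0 <= g x <= 1) ->
     (\int[mu]_x (g x)%:E = \int[nu]_x (g x)%:E)%E) ->
  forall A, measurable A -> mu A = nu A.
Proof.
move=> mn; pose G := @RGenInftyO.G R.
have Gray k : G `]-oo, k[%classic by exists k.
apply: (measure_unique G (fun k => `]-oo, k%:R[%classic)) => //.
- exact: RGenInftyO.measurableE.
- move=> _ _ [x ->] [y ->]; exists (Num.min x y).
  by apply/seteqP; split => z /=; rewrite !in_itv/= lt_min => /andP.
- apply/seteqP; split => // x _; exists (Num.truncn `|x|).+1 => //=.
  by rewrite in_itv/= (le_lt_trans (ler_norm x))// real_truncnS_gt// num_real.
- move=> _ [a ->].
  have rayE (P : probability R R) :
      (fun m => \int[P]_x (ramp a m x)%:E)%E @ \oo --> P `]-oo, a[%classic.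
    have <- : (\int[P]_x (\1_(`]-oo, a[%classic) x : R)%:E)%E = P `]-oo, a[%classic.
      by rewrite integral_indic// setIT.
    apply: dominated_convergence_le1 => //.
    - by move=> m; apply: continuous_measurable_fun; exact: continuous_ramp.
    - by move=> m x; exact: ramp_ge0_le1.
    - by apply/aeW => x; exact: cvg_ramp.
  apply: (@cvg_unique _ _ _ _ _ _ (rayE mu)) => //.
  have -> : (fun m => \int[mu]_x (ramp a m x)%:E)%E
      = (fun m => \int[nu]_x (ramp a m x)%:E)%E.
    apply/funext => m; apply: mn; first exact: continuous_ramp.
    by move=> x; exact: ramp_ge0_le1.
  exact: rayE.
- by move=> k; rewrite (le_lt_trans (probability_le1 _ _)) ?ltry.
Qed.

End laws_on_the_line.

Definition centred_gaussian {R : realType} d {T : measurableType d}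
    (P : probability T R) (X : T -> R) (v : R) : Prop :=
  forall A : set R, measurable A -> P (X @^-1` A) = gaussian_law 0 v A.

(** * Centred normal variables: scaling, moments, limits and sums *)

Section gaussian_random_variables.
Context {R : realType} d {T : measurableType d} (P : probability T R).
Implicit Types X Y : T -> R.
Local Notation mfun f := (measurable_fun [set: T] f).
Local Notation N01 := (normal_prob (0 : R) 1).

Lemma measurable_preimage d' (T' : measurableType d') (f : T -> T') (A : set T') :
  mfun f -> measurable A -> measurable (f @^-1` A).
Proof. by move=> mf mA; rewrite -[X in measurable X]setTI; exact: mf. Qed.

Lemma centred_gaussianE X v (A : set R) : 0 <= v -> centred_gaussian P X v ->
  measurable A -> P (X @^-1` A) = N01 ((fun x => Num.sqrt v * x) @^-1` A).
Proof.
move=> v0 Xv mA; rewrite Xv// gaussian_law_affine//.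
by congr (N01 _); apply/seteqP; split => x /=; rewrite addr0.
Qed.

Lemma eq_ae_preimage X Y (A : set R) : mfun X -> mfun Y -> measurable A ->
  {ae P, forall w, X w = Y w} -> P (X @^-1` A) = P (Y @^-1` A).
Proof.
move=> mX mY mA XY; rewrite -[X @^-1` A]setIT -[Y @^-1` A]setIT.
rewrite -!(integral_indic P measurableT); try exact: measurable_preimage.
apply: ae_eq_integral => //.
- by apply/measurable_EFinP/measurable_indic; exact: measurable_preimage.
- by apply/measurable_EFinP/measurable_indic; exact: measurable_preimage.
apply: filterS XY => w XYw _; congr EFin; rewrite !indicE; congr (_ : bool)%:R.
by apply/idP/idP; rewrite !inE/= XYw.
Qed.

Lemma normal_prob_opp (A : set R) : measurable A -> N01 (-%R @^-1` A) = N01 A.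
Proof.
move=> mA; have -> : N01 A = normal_prob 0 (-1) A.
  apply: eq_integral => x _; rewrite !normal_pdfE ?oppr_eq0 ?oner_eq0//.
  by rewrite /normal_peak /normal_fun sqrrN.
rewrite [RHS]normal_prob_affine ?oppr_eq0 ?oner_eq0//; congr (normal_prob _ _ _).
by apply/seteqP; split => x /=; rewrite mulN1r addr0.
Qed.

Lemma centred_gaussianZ (a v : R) X : 0 <= v -> centred_gaussian P X v ->
  centred_gaussian P (fun w => a * X w) (a ^+ 2 * v).
Proof.
move=> v0 Xv A mA; rewrite gaussian_law_affine//; last by rewrite mulr_ge0 ?sqr_ge0.
have ma (c : R) : measurable_fun [set: R] (fun x => c * x).
  exact: measurable_funM.
have mB (c : R) (B : set R) : measurable B -> measurable ((fun x => c * x) @^-1` B).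
  by move=> mB; rewrite -[X in measurable X]setTI; exact: ma.
rewrite (centred_gaussianE (A := (fun x => a * x) @^-1` A) v0 Xv); last exact: mB.
rewrite sqrtrM ?sqr_ge0// sqrtr_sqr.
have [a0|a0] := leP 0 a.
  by congr (normal_prob _ _ _); apply/seteqP; split => x /=; rewrite ger0_norm// addr0 mulrA.
(* For a < 0 the scale is |a| sqrt(v); the sign is absorbed by the symmetry of the standard normal
   law. *)
transitivity (N01 (-%R @^-1` ((fun x => Num.sqrt v * x) @^-1` ((fun x => a * x) @^-1` A)))).
  by rewrite normal_prob_opp//; exact: (mB _ _ (mB _ _ mA)).
congr (normal_prob _ _ _); apply/seteqP; split => x /=;
  by rewrite ltr0_norm// addr0 !mulrN !mulNr mulrA.
Qed.

Lemma ge0_integral_gaussian X v (g : R -> \bar R) : mfun X -> 0 <= v ->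
  centred_gaussian P X v -> measurable_fun [set: R] g -> (forall x, 0 <= g x)%E ->
  (\int[P]_w g (X w) = \int[N01]_x g (Num.sqrt v * x)%R)%E.
Proof.
move=> mX v0 Xv mg g0.
have ms : measurable_fun [set: R] (fun x => Num.sqrt v * x) by exact: measurable_funM.
rewrite -(ge0_integral_law P mX measurableT mg g0).
rewrite -(ge0_integral_law N01 ms measurableT mg g0).
apply: eq_measure_integral => A mA _.
exact: centred_gaussianE.
Qed.

Lemma sqint_gaussian X v : mfun X -> 0 <= v -> centred_gaussian P X v ->
  sqint P X = v%:E.
Proof.
move=> mX v0 Xv; rewrite /sqint (ge0_integral_gaussian (g := fun x => (x ^+ 2)%:E) mX v0 Xv).
- under eq_integral do rewrite exprMn EFinM sqr_sqrtr//.
  rewrite ge0_integralZl_EFin//.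
  + by rewrite normal_second_moment mule1.
  + by move=> x _; rewrite lee_fin sqr_ge0.
  + by apply/measurable_EFinP/measurable_funX.
- by apply/measurable_EFinP/measurable_funX.
- by move=> x; rewrite lee_fin sqr_ge0.
Qed.

Lemma integrable_of_sqint X : mfun X -> (sqint P X < +oo)%E ->
  P.-integrable setT (EFin \o X).
Proof.
move=> mX Xoo; have := @integrable_mul_sqr R _ T P X (cst 1) mX _ Xoo.
under [X in _ -> _ -> _.-integrable _ X]eq_fun do rewrite mulr1.
apply => //; rewrite /sqint/=.
under eq_integral do rewrite expr1n.
by rewrite integral_cst// mul1e (le_lt_trans (probability_le1 P measurableT))// ltry.
Qed.

(** X and -X have the same law, so the positive and negative parts have equal integrals, finite
    because the second moment is. *)
Lemma integral_gaussian0 X v : mfun X -> 0 <= v -> centred_gaussian P X v ->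
  (\int[P]_w (X w)%:E = 0)%E.
Proof.
move=> mX v0 Xv.
have iX : P.-integrable setT (EFin \o X).
  by apply: integrable_of_sqint => //; rewrite (sqint_gaussian mX v0 Xv) ltry.
have mN : mfun (fun w => -1 * X w) by exact: measurable_funM.
have := @centred_gaussianZ (-1) v X v0 Xv; rewrite sqrrN expr1n mul1r => NXv.
pose pos (x : R) : \bar R := maxe x%:E 0.
have mpos : measurable_fun [set: R] pos.
  by apply: measurable_maxe => //; exact/measurable_EFinP.
have pos0 x : (0 <= pos x)%E by rewrite /pos le_max lexx orbT.
rewrite integralE.
have -> : (\int[P]_w (EFin \o X)^\- w = \int[P]_w (EFin \o X)^\+ w)%E.
  transitivity (\int[P]_w pos (-1 * X w)%R)%E.
    by apply: eq_integral => w _; rewrite funenegE/= /pos mulN1r EFinN.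
  transitivity (\int[P]_w pos (X w))%E;
    last by apply: eq_integral => w _; rewrite funeposE.
  rewrite (ge0_integral_gaussian mN v0 NXv mpos pos0).
  by rewrite (ge0_integral_gaussian mX v0 Xv mpos pos0).
rewrite subee//; apply: integrable_pos_fin_num => //.
Qed.

(** For a continuous g with values in [0, 1], dominated convergence applies to g(X_k) and also to
    g(sqrt(v_k) x) under the fixed standard law. The variance enters only inside g, so it may tend
    to 0. *)
Lemma centred_gaussian_cvg (X_ : nat -> T -> R) X (v_ : nat -> R) (v : R) :
  (forall k, mfun (X_ k)) -> mfun X -> (forall k, 0 <= v_ k) -> 0 <= v ->
  (forall k, centred_gaussian P (X_ k) (v_ k)) ->
  {ae P, forall w, X_ ^~ w @ \oo --> X w} -> v_ @ \oo --> v ->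
  centred_gaussian P X v.
Proof.
move=> mX_ mX v_0 v0 Xv_ XX vv A mA; rewrite gaussian_law_affine//.
have ms (c : R) : measurable_fun [set: R] (fun x => c * x + 0).
  exact: measurable_affine.
suff : law P mX A = law N01 (ms (Num.sqrt v)) A by [].
apply: eq_probability_continuous => // g cg g01.
have mg : measurable_fun [set: R] g by exact: continuous_measurable_fun.
have mgE : measurable_fun [set: R] (EFin \o g) by exact/measurable_EFinP.
have g0 x : (0 <= (EFin \o g) x)%E by rewrite lee_fin; case/andP: (g01 x).
rewrite (ge0_integral_law P mX measurableT mgE g0).
rewrite (ge0_integral_law N01 (ms _) measurableT mgE g0) !preimage_setT.
have lim1 : (fun k => \int[P]_w (g (X_ k w))%:E)%E @ \oo --> (\int[P]_w (g (X w))%:E)%E.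
  apply: dominated_convergence_le1 => //.
  - by move=> k; exact: (measurableT_comp mg (mX_ k)).
  - exact: (measurableT_comp mg mX).
  - apply: filterS XX => w Xw.
    by apply: (@continuous_cvg _ _ _ \oo _ (X_ ^~ w) g) => //; exact: cg.
have lim2 : (fun k => \int[N01]_x (g (Num.sqrt (v_ k) * x + 0))%:E)%E @ \oo -->
    (\int[N01]_x (g (Num.sqrt v * x + 0))%:E)%E.
  apply: (@dominated_convergence_le1 _ _ _ N01) => //.
  - by move=> k; exact: (measurableT_comp mg (ms _)).
  - exact: (measurableT_comp mg (ms _)).
  - apply/aeW => x.
    apply: (@continuous_cvg _ _ _ \oo _ (fun k => Num.sqrt (v_ k) * x + 0) g).
      exact: cg.
    apply: cvgD; last exact: cvg_cst.
    apply: cvgM; last exact: cvg_cst.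
    by apply: (@continuous_cvg _ _ _ \oo _ v_ Num.sqrt) => //; exact: sqrt_continuous.
apply: (@cvg_unique _ _ _ _ _ _ lim1) => //.
have -> : (fun k => \int[P]_w (g (X_ k w))%:E)%E =
    (fun k => \int[N01]_x (g (Num.sqrt (v_ k) * x + 0))%:E)%E.
  apply/funext => k; rewrite (ge0_integral_gaussian (g := EFin \o g) (mX_ k) (v_0 k) (Xv_ k))//.
  by apply: eq_integral => x _; rewrite addr0.
exact: lim2.
Qed.

(** A variable of variance 0 is a.s. 0 and drops out. Otherwise independence makes the joint law a
    product measure, whose sections turn the law of the sum into the convolution. *)
Lemma centred_gaussianD X Y (a b : R) : mfun X -> mfun Y -> 0 <= a -> 0 <= b ->
  centred_gaussian P X a -> centred_gaussian P Y b ->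
  (forall A B : set R, measurable A -> measurable B ->
     P (X @^-1` A `&` Y @^-1` B) = P (X @^-1` A) * P (Y @^-1` B))%E ->
  centred_gaussian P (fun w => X w + Y w) (a + b).
Proof.
move=> mX mY a0 b0 Xa Yb indep A mA.
have zero Z : mfun Z -> centred_gaussian P Z 0 -> {ae P, forall w, Z w = 0}.
  by move=> mZ Z0; apply: sqint_eq0 => //; rewrite (sqint_gaussian mZ (lexx _) Z0).
have mXpY : mfun (fun w => X w + Y w) by exact: measurable_funD.
have [a_eq0|a_neq0] := eqVneq a 0.
  move: Xa; rewrite a_eq0 add0r => /(zero _ mX) X0.
  rewrite -Yb//; apply: eq_ae_preimage => //.
  by apply: filterS X0 => w /= ->; rewrite add0r.
have [b_eq0|b_neq0] := eqVneq b 0.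
  move: Yb; rewrite b_eq0 addr0 => /(zero _ mY) Y0.
  rewrite -Xa//; apply: eq_ae_preimage => //.
  by apply: filterS Y0 => w /= ->; rewrite addr0.
have mXY : mfun (fun w => (X w, Y w)) by exact: measurable_fun_pair.
have mD : measurable [set p : R * R | A (p.1 + p.2)].
  have mD : measurable_fun [set: R * R] (fun p => p.1 + p.2).
    exact: measurable_funD.
  by have := mD measurableT A mA; rewrite setTI.
have mS (B : set R) x : measurable B -> measurable [set y | B (x + y)].
  have mxD : measurable_fun [set: R] (fun y => x + y) by exact: measurable_funD.
  by move=> mB'; have := mxD measurableT B mB'; rewrite setTI.
pose mu : probability R R := law P mX; pose nu : probability R R := law P mY.
transitivity (image_measure P mXY [set p | A (p.1 + p.2)]) => //.
transitivity ((mu \x nu)%E [set p | A (p.1 + p.2)]).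
  by apply/esym/product_measure_unique => // B C mB mC; exact: indep.
transitivity (\int[mu]_x gaussian_law 0 b [set y | A (x + y)%R])%E.
  apply: eq_integral => x _ /=; rewrite -Yb; last exact: mS.
  by congr (P (Y @^-1` _)); apply/seteqP; split => y; rewrite /xsection/= inE.
have muE (B : set R) : measurable B -> mu B = gaussian_law 0 a B by exact: Xa.
have sq (c : R) : 0 <= c -> c != 0 -> Num.sqrt c != 0.
  by move=> c0 cn0; rewrite sqrtr_eq0 -ltNge lt_neqAle eq_sym cn0.
(* The identity only changes the measurable structure that the line carries. *)
have mid : measurable_fun [set: measurableTypeR R] (fun x : measurableTypeR R => x : R).
  by move=> _ B mB; rewrite setTI.
pose na : probability R R := law (normal_prob 0 (Num.sqrt a)) mid.
transitivity (\int[na]_x gaussian_law 0 b [set y | A (x + y)%R])%E.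
  apply: eq_measure_integral => B mB _.
  by have := muE B mB; rewrite /gaussian_law (negbTE a_neq0).
transitivity (\int[na]_x normal_prob 0 (Num.sqrt b) [set y | A (x + y)%R])%E.
  by apply: eq_integral => x _; rewrite /gaussian_law (negbTE b_neq0).
have mnb : measurable_fun [set: R] (fun x => normal_prob 0 (Num.sqrt b) [set y | A (x + y)]).
  rewrite (_ : (fun x => _) = (fun x => nu (xsection [set p : R * R | A (p.1 + p.2)] x))).
    exact: measurable_fun_xsection.
  apply/funext => x; have := Yb _ (mS A x mA); rewrite /gaussian_law (negbTE b_neq0) => <-.
  by congr (P (Y @^-1` _)); apply/seteqP; split => y; rewrite /xsection/= inE.
rewrite /na (ge0_integral_law (normal_prob 0 (Num.sqrt a)) mid measurableT mnb)//.
have := @normal_prob_conv R _ _ A (sq _ a0 a_neq0) (sq _ b0 b_neq0) mA.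
rewrite !sqr_sqrtr// /gaussian_law ifF//.
by apply/negbTE; rewrite paddr_eq0// negb_and a_neq0.
Qed.

End gaussian_random_variables.

(** * Independence of generated sigma-algebras *)

(** The class closed under intersection generated by G; the inductive form gives access to the
    finitely many events involved. *)
Inductive finite_intersection {T : Type} (G : set (set T)) : set T -> Prop :=
| finite_intersection_setT : finite_intersection G setT
| finite_intersection_setI A B :
    G A -> finite_intersection G B -> finite_intersection G (A `&` B).

Definition independent_systems {R : realType} d {T : measurableType d}
    (P : probability T R) (F G : set (set T)) : Prop :=
  forall A B, F A -> G B -> P (A `&` B) = (P A * P B)%E.

Section generated_sigma_algebras.
Context {T : Type}.
Implicit Types F G : set (set T).

Lemma finite_intersection_closed G : setI_closed (finite_intersection G).
Proof.
move=> A B; elim=> [|C D GC _ IH] GB; first by rewrite setTI.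
by rewrite -setIA; apply: finite_intersection_setI => //; exact: IH.
Qed.

Lemma sub_finite_intersection G : G `<=` finite_intersection G.
Proof.
move=> A GA; rewrite -(setIT A).
by apply: finite_intersection_setI => //; exact: finite_intersection_setT.
Qed.

Lemma sub_gen_sigma_algebra F G : F `<=` <<s G >> -> <<s F >> `<=` <<s G >>.
Proof. by move=> FG; apply: smallest_sub => //; exact: smallest_sigma_algebra. Qed.

End generated_sigma_algebras.

(** * Product rules: from generators to sigma-algebras, and for blocks of variables *)

Section independent_systems.
Context {R : realType} d {T : measurableType d} (P : probability T R).
Implicit Types F G : set (set T).

Lemma gen_measurable G : G `<=` measurable -> <<s G >> `<=` (@measurable _ T).
Proof.
move=> Gm; apply: smallest_sub => //; split.
- exact: measurable0.
- by move=> A mA; rewrite setTD; exact: measurableC.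
- by move=> F mF; exact: bigcupT_measurable.
Qed.

Lemma independent_systemsC F G :
  independent_systems P F G -> independent_systems P G F.
Proof. by move=> FG A B GA FB; rewrite setIC muleC FG. Qed.

(** For fixed B, the finite measures A |-> P(A & B) and A |-> P(A) P(B) agree on F, hence on the
    sigma-algebra it generates. *)
Lemma independent_systems_genl F G : setI_closed F -> F setT ->
  F `<=` measurable -> G `<=` measurable ->
  independent_systems P F G -> independent_systems P <<s F >> G.
Proof.
move=> FI FT Fm Gm FG A B sFA GB; have mB : measurable B by exact: Gm.
have PB0 : 0 <= fine (P B) by exact: fine_ge0.
pose m2 := mscale (NngNum PB0) P.
have <- : m2 A = (P A * P B)%E.
  by rewrite /m2/= /mscale/= fineK ?fin_num_measure// muleC.
transitivity (mrestr P mB A) => //.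
apply: (g_sigma_algebra_measure_unique F Fm (fun=> setT)) => //.
- by apply/seteqP; split => // x _; exists 0%N.
- move=> C FC; rewrite /m2/= /mscale/= fineK ?fin_num_measure// muleC.
  exact: FG.
- move=> _; apply: le_lt_trans (ltry 1%R); rewrite /mrestr.
  by apply: probability_le1; exact: measurableI.
Qed.

Lemma independent_systems_gen F G :
  F `<=` measurable -> G `<=` measurable ->
  independent_systems P (finite_intersection F) (finite_intersection G) ->
  independent_systems P <<s F >> <<s G >>.
Proof.
move=> Fm Gm FG.
have fim (K : set (set T)) : K `<=` measurable -> finite_intersection K `<=` (@measurable _ T).
  move=> Km A; elim=> [|B C KB _ mC]; first exact: measurableT.
  by apply: measurableI => //; exact: Km.
have sub (K : set (set T)) : <<s K >> `<=` <<s finite_intersection K >>.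
  apply: sub_gen_sigma_algebra => A KA; apply: sub_sigma_algebra.
  exact: sub_finite_intersection.
have h1 : independent_systems P <<s finite_intersection F >> (finite_intersection G).
  apply: independent_systems_genl => //.
  - exact: finite_intersection_closed.
  - exact: finite_intersection_setT.
  - exact: fim.
  - exact: fim.
have h2 : independent_systems P <<s finite_intersection G >> <<s finite_intersection F >>.
  apply: independent_systems_genl => //.
  - exact: finite_intersection_closed.
  - exact: finite_intersection_setT.
  - exact: fim.
  - by apply: gen_measurable; exact: fim.
  - exact: independent_systemsC.
by move=> A B FA GB; rewrite setIC muleC h2//; exact: sub.
Qed.

Definition block_events n (X : 'I_n -> T -> R) (D : pred nat) : set (set T) :=
  [set C | exists (k : 'I_n) (A : set R), [/\ D k, measurable A & C = X k @^-1` A]].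

(** A normal form with exactly one event per index, trivial outside the block: the shape in which
    [independent_rvs] states the product rule. *)
Lemma finite_intersection_block n (X : 'I_n -> T -> R) (D : pred nat) E :
  finite_intersection (block_events X D) E ->
  exists A : 'I_n -> set R, [/\ forall k, measurable (A k),
    (forall k : 'I_n, ~~ D k -> A k = setT) &
    E = \bigcap_(k in [set: 'I_n]) X k @^-1` A k].
Proof.
elim=> [|_ B [k [A0 [Dk mA0 ->]]] _ [A [mA AT ->]]].
  exists (fun=> setT); split => //.
  by apply/seteqP; split.
exists (fun i => if i == k then A0 `&` A i else A i); split.
- by move=> i; case: ifP => _ //; exact: measurableI.
- by move=> i nDi; case: eqP => [ik|_]; [rewrite ik Dk in nDi|exact: AT].
apply/seteqP; split => w /=.
  move=> [A0w Aw] i _ /=; have := Aw i I.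
  by case: eqP => [->|//] ?; split.
move=> Aw; split; first by have := Aw k I; rewrite eqxx => -[].
by move=> i _; have := Aw i I; case: eqP => [_ []|].
Qed.

(** Each index contributes a possibly nontrivial event to one of the two intersections and [setT],
    of probability 1, to the other, so the product over all indices factors. *)
Lemma independent_blocks n (X : 'I_n -> T -> R) (D : pred nat) :
  (forall k, measurable_fun setT (X k)) -> independent_rvs P X ->
  independent_systems P <<s block_events X D >> <<s block_events X (predC D) >>.
Proof.
move=> mX iX; have bm D' : block_events X D' `<=` measurable.
  by move=> _ [k [A [_ mA ->]]]; exact: measurable_preimage.
apply: independent_systems_gen => //.
move=> E F /finite_intersection_block[A [mA AT ->]] /finite_intersection_block[B [mB BT ->]].
pose C (k : 'I_n) := if D k then A k else B k.
have mC k : measurable (C k) by rewrite /C; case: ifP.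
have -> : (\bigcap_(k in [set: 'I_n]) X k @^-1` A k) `&`
    (\bigcap_(k in [set: 'I_n]) X k @^-1` B k) = \bigcap_(k in [set: 'I_n]) X k @^-1` C k.
  rewrite -bigcapI; apply: eq_bigcapr => k _; rewrite -preimage_setI /C.
  by case: ifPn => Dk; [rewrite BT ?setIT//= negbK|rewrite AT ?setTI].
rewrite !iX// -big_split/=; apply: eq_bigr => k _; rewrite /C.
case: ifPn => Dk.
  by rewrite BT/= ?negbK// preimage_setT probability_setT mule1.
by rewrite AT// preimage_setT probability_setT mul1e.
Qed.

End independent_systems.

(** * Integrals of step functions against Brownian motion *)

Section step_functionals.
Context {R : realType}.
Implicit Types (a b u : R) (t c : nat -> R) (G : R -> R) (F : (R -> R) -> R).

Definition increment_sum n t c G : R := \sum_(i < n) c i * (G (t i.+1) - G (t i)).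

(* A step function and its integral are the values of one functional, at the
   functions [s |-> 1_(x <= s)] and [s |-> W s w] respectively. *)
Definition step_functional a b F : Prop :=
  exists n t c, subdivision a b n t /\ forall G, F G = increment_sum n t c G.

Definition upto (x s : R) : R := (x <= s)%R%:R.

Lemma subdivision_itv a b n t i :
  subdivision a b n t -> (i <= n)%N -> a <= t i <= b.
Proof.
move=> [at0 tS tnb] i_n.
have mono j k : (j + k <= n)%N -> t j <= t (j + k)%N.
  elim: k => [|k IH]; first by rewrite addn0.
  by rewrite addnS => jk; apply: le_trans (IH (ltnW jk)) (tS _ jk).
apply/andP; split; first by rewrite (le_trans at0)// -[i]add0n mono.
by apply: le_trans tnb; have := mono i (n - i)%N; rewrite subnKC//; exact.
Qed.

Lemma step_fun_upto a b n t c x : subdivision a b n t ->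
  step_fun n t c x = increment_sum n t c (upto x).
Proof.
move=> [_ tS _]; apply: eq_bigr => i _; congr (_ * _).
rewrite indicE /upto; have ti := tS i (ltn_ord i).
have [xt|xt] := leP x (t i).
  rewrite (le_trans xt ti) memNset ?subrr//= in_itv/= => /andP[].
  by rewrite ltNge xt.
rewrite subr0; have [xt'|xt'] := leP x (t i.+1).
  by rewrite mem_set//= in_itv/= xt xt'.
by rewrite memNset//= in_itv/= => /andP[_]; rewrite leNgt xt'.
Qed.

(** Summation by parts: G(q) - G(a) is the sum of the increments up to q, so an increment receives
    the coefficients of all times to its right. The induction requires that the subdivision start
    exactly at a. *)
Lemma formal_increment_sum_sorted a b (L : seq (R * R)) :
  path <=%R a [seq q.2 | q <- L] -> last a [seq q.2 | q <- L] <= b ->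
  exists n t c, [/\ t 0%N = a, subdivision a b n t &
    forall G, \sum_(q <- L) q.1 * (G q.2 - G a) = increment_sum n t c G].
Proof.
elim: L a => [|p L IH] a /=.
  move=> _ ab; exists 0%N, (fun=> a), (fun=> 0); split => // G.
  by rewrite big_nil /increment_sum big_ord0.
move=> /andP[ap pL] lb; have [n [t [c [t0 [h1 h2 h3] incE]]]] := IH _ pL lb.
exists n.+1, (fun i => if i is j.+1 then t j else a),
  (fun i => if i is j.+1 then c j else \sum_(q <- p :: L) q.1); split => //.
  split => //; case=> [_|i]; first by rewrite t0.
  by rewrite ltnS => /h2.
move=> G; rewrite /increment_sum big_ord_recl/= -/(increment_sum n t c G) -incE t0.
rewrite !big_cons mulrDl -addrA; congr (_ + _).
by rewrite mulr_suml -big_split/=; apply: eq_bigr => q _; ring.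
Qed.

Lemma formal_step_functional a b (L : seq (R * R)) :
  a <= b -> (forall q, q \in L -> a <= q.2 <= b) ->
  step_functional a b (fun G => \sum_(q <- L) q.1 * (G q.2 - G a)).
Proof.
move=> ab Lab; pose r (p q : R * R) := p.2 <= q.2.
have rtot : total r by move=> p q; exact: le_total.
have perm : perm_eq (sort r L) L by rewrite perm_sort.
have srt : sorted <=%R [seq q.2 | q <- sort r L].
  by rewrite sorted_map; exact: sort_sorted.
have Lin q : q \in [seq q.2 | q <- sort r L] -> a <= q <= b.
  by move=> /mapP[p]; rewrite mem_sort => /Lab ? ->.
have [||n [t [c [_ sub incE]]]] := @formal_increment_sum_sorted a b (sort r L).
- case: [seq _ | _ <- _] srt Lin => //= x s -> /(_ x); rewrite inE eqxx => /(_ isT).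
  by move=> /andP[-> _].
- have [->|] := eqVneq [seq q.2 | q <- sort r L] [::]; first by [].
  case: [seq _ | _ <- _] Lin => //= x s /(_ (last x s)).
  by rewrite mem_last => /(_ isT)/andP[].
by exists n, t, c; split => // G; rewrite -incE (perm_big _ perm).
Qed.

Lemma step_functional_itv a b F : step_functional a b F -> a <= b.
Proof.
move=> [n [t [c [/[dup] [[at0 _ _]] /subdivision_itv tab _]]]].
by apply: le_trans at0 _; have /andP[] := tab 0%N (leq0n _).
Qed.

(** The two subdivisions may differ. Writing both functionals as combinations of values G(q) - G(a)
    replaces the common refinement by concatenation and sorting. *)
Lemma step_functional_lincomb a b F F' (k l : R) :
  step_functional a b F -> step_functional a b F' ->
  step_functional a b (fun G => k * F G + l * F' G).
Proof.
move=> sF; have ab := step_functional_itv sF.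
move: sF => [n [t [c [sub FE]]]] [n' [t' [c' [sub' FE']]]].
(* Each increment gives x e_i at its right end and - x e_i at its left end, so G(a) cancels. *)
pose L m s e (x : R) := [seq (x * e i, s i.+1) | i <- iota 0 m] ++
  [seq (- (x * e i), s i) | i <- iota 0 m] : seq (R * R).
have LE m s e (x : R) G :
    \sum_(q <- L m s e x) q.1 * (G q.2 - G a) = x * increment_sum m s e G.
  rewrite big_cat/= !big_map -big_split/= mulr_sumr.
  rewrite -(big_mkord xpredT (fun i => x * (e i * (G (s i.+1) - G (s i))))).
  by rewrite /index_iota subn0; apply: eq_bigr => i _; ring.
have Lin m s e (x : R) q : subdivision a b m s -> q \in L m s e x -> a <= q.2 <= b.
  move=> subm; rewrite mem_cat => /orP[] /mapP[i]; rewrite mem_iota add0n => im ->/=.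
    exact: (subdivision_itv subm).
  by apply: (subdivision_itv subm); exact: ltnW.
have [|N [s [e [subN sE]]]] :=
    @formal_step_functional a b (L n t c k ++ L n' t' c' l) ab.
  by move=> q; rewrite mem_cat => /orP[]; exact: Lin.
exists N, s, e; split => // G.
by rewrite -sE big_cat/= !LE FE FE'.
Qed.

Lemma step_functional_widen a b a' b' F : a' <= a -> b <= b' ->
  step_functional a b F -> step_functional a' b' F.
Proof.
move=> aa bb [n [t [c [[h1 h2 h3] FE]]]]; exists n, t, c; split => //.
by split => //; [exact: le_trans h1|exact: le_trans bb].
Qed.

(** Truncating the times at u restricts the integral to [a, u], whether or not u is a subdivision
    point. *)
Lemma step_functional_min a b u F : a <= u -> step_functional a b F ->
  step_functional a u (fun G => F (fun s => G (Num.min s u))).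
Proof.
move=> au [n [t [c [[h1 h2 h3] FE]]]].
exists n, (fun i => Num.min (t i) u), c; split => //; split.
- by rewrite le_min h1.
- by move=> i /h2 ti; rewrite le_min !ge_min ti lexx/= orbT.
- by rewrite ge_min lexx orbT.
Qed.

Lemma step_functional_max a b u F : u <= b -> step_functional a b F ->
  step_functional u b (fun G => F (fun s => G (Num.max s u))).
Proof.
move=> ub [n [t [c [[h1 h2 h3] FE]]]].
exists n, (fun i => Num.max (t i) u), c; split => //; split.
- by rewrite le_max lexx orbT.
- by move=> i /h2 ti; rewrite ge_max !le_max ti lexx/= orbT.
- by rewrite ge_max h3.
Qed.

(** G(min s u) + G(max s u) = G(s) + G(u), and the constant G(u) has no increments. *)
Lemma step_functional_minDmax a b u F G : step_functional a b F ->
  F (fun s => G (Num.min s u)) + F (fun s => G (Num.max s u)) = F G.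
Proof.
move=> [n [t [c [_ FE]]]]; rewrite !FE -big_split; apply: eq_bigr => i _ /=.
have h s : G (Num.min s u) = G s + G u - G (Num.max s u).
  by have [su|us] := leP s u; ring.
by rewrite !h; ring.
Qed.

Lemma eq_step_functional a b F G G' : step_functional a b F ->
  (forall s, a <= s <= b -> G s = G' s) -> F G = F G'.
Proof.
move=> [n [t [c [sub FE]]]] GG'; rewrite !FE; apply: eq_bigr => i _.
by rewrite !GG'//; apply: (subdivision_itv sub) => //; exact: ltnW.
Qed.

Lemma step_functional_affine a b F (k l : R) G : step_functional a b F ->
  F (fun s => k * G s + l) = k * F G.
Proof.
move=> [n [t [c [sub FE]]]]; rewrite !FE mulr_sumr; apply: eq_bigr => i _; ring.
Qed.

Lemma step_functional_cst a b F (l : R) : step_functional a b F -> F (fun=> l) = 0.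
Proof.
move=> sF; rewrite -[RHS](mul0r (F (fun=> l))) -(step_functional_affine 0 l _ sF).
by congr F; apply/funext => s; rewrite mul0r add0r.
Qed.

(** On the side of the integrand, truncating time at u is multiplication by the indicator of x <=
    u. *)
Lemma step_functional_upto_min a b u F x : step_functional a b F ->
  F (fun s => upto x (Num.min s u)) = (x <= u)%R%:R * F (upto x).
Proof.
move=> sF; rewrite -(step_functional_affine _ 0 _ sF); congr F.
by apply/funext => s; rewrite addr0 /upto le_min -natrM mulnb andbC.
Qed.

Lemma step_functional_upto_max a b u F x : step_functional a b F ->
  F (fun s => upto x (Num.max s u)) = (u < x)%R%:R * F (upto x).
Proof.
move=> sF; rewrite -(step_functional_affine _ (x <= u)%R%:R _ sF); congr F.
apply/funext => s; rewrite /upto le_max ltNge.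
by case: (x <= u); rewrite ?orbT ?orbF/= ?mul0r ?add0r ?mul1r ?addr0.
Qed.

(** For x outside ]a, b] the function [upto x] is constant on [a, b]. Step functions thus vanish off
    the interval and can be integrated over the whole line. *)
Lemma step_functional_out a b F x : step_functional a b F ->
  ~~ (a < x <= b) -> F (upto x) = 0.
Proof.
move=> sF; rewrite negb_and -leNgt -ltNge => /orP[xa|bx].
  rewrite (@eq_step_functional a b F (upto x) (fun=> 1) sF).
    exact: step_functional_cst sF.
  by move=> s /andP[as_ _]; rewrite /upto (le_trans xa as_).
rewrite (@eq_step_functional a b F (upto x) (fun=> 0) sF).
  exact: step_functional_cst sF.
by move=> s /andP[_ sb]; rewrite /upto leNgt (le_lt_trans sb bx).
Qed.

End step_functionals.

Section step_isometry.
Context {R : realType}.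
Local Notation leb := (@lebesgue_measure R).
Implicit Types (a b u : R) (t c : nat -> R) (F : (R -> R) -> R).

Lemma measurable_upto (s : R) : measurable_fun [set: R] (fun x => upto x s).
Proof.
rewrite (_ : (fun x => _) = \1_(`]-oo, s]%classic)); first exact: measurable_indic.
apply/funext => x; rewrite indicE /upto; congr (nat_of_bool _)%:R.
by apply/idP/idP; rewrite inE/= in_itv.
Qed.

Lemma measurable_step_fun a b F : step_functional a b F ->
  measurable_fun [set: R] (fun x => F (upto x)).
Proof.
move=> [n [t [c [_ FE]]]].
rewrite (_ : (fun x => _) = fun x => \sum_(i < n) c i * (upto x (t i.+1) - upto x (t i))).
  apply: measurable_sum => i; apply: measurable_funM => //.
  by apply: measurable_funB; exact: measurable_upto.
by apply/funext => x; rewrite FE.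
Qed.

(** The earlier terms vanish beyond t_n and the last one lives on ]t_n, t_(n+1)], so the square has
    no cross term. *)
Lemma sqint_increment_sum a b n t c : subdivision a b n t ->
  sqint leb (fun x => increment_sum n t c (upto x))
  = (\sum_(i < n) c i ^+ 2 * (t i.+1 - t i))%:E.
Proof.
elim: n => [|n IH] sub.
  rewrite big_ord0 /sqint; under eq_integral do rewrite /increment_sum big_ord0 expr0n/=.
  by rewrite integral0.
have [at0 tS tb] := sub.
have sub' : subdivision a (t n) n t by split => // i /ltnW; exact: tS.
have sF : step_functional a (t n) (increment_sum n t c) by exists n, t, c.
have subb : subdivision a b n t.
  by split => //; [move=> i /ltnW; exact: tS|exact: le_trans (tS n _) tb].
rewrite big_ord_recr/= EFinD -IH//.
transitivity (\int[leb]_x (((increment_sum n t c (upto x)) ^+ 2)%:E +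
   (c n ^+ 2 * \1_(`]t n, t n.+1]%classic) x)%:E))%E.
  apply: eq_integral => x _; rewrite -EFinD; congr EFin.
  rewrite /increment_sum big_ord_recr/= -/(increment_sum n t c (upto x)).
  rewrite indicE; have [xt|xt] := leP x (t n).
    rewrite /upto xt (le_trans xt (tS _ _))// memNset//= ?in_itv/= ?ltNge ?xt//.
    by rewrite subrr !mulr0 !addr0.
  rewrite (step_functional_out sF); last by rewrite negb_and -!ltNge xt orbT.
  rewrite expr0n/= !add0r /upto (leNgt x (t n)) xt/= subr0 exprMn.
  congr (_ * _); have [xt'|xt'] := leP x (t n.+1).
    by rewrite mem_set/= ?in_itv/= ?xt// expr1n.
  by rewrite memNset/= ?in_itv/= ?leNgt ?xt' ?andbF// expr0n.
rewrite ge0_integralD//; last 4 first.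
- by move=> x _; rewrite lee_fin sqr_ge0.
- by apply: measurable_sqr; exact: measurable_step_fun sF.
- by move=> x _; rewrite lee_fin mulr_ge0 ?sqr_ge0.
- by apply/measurable_EFinP; apply: measurable_funM.
congr (_ + _)%E; under eq_integral do rewrite EFinM.
rewrite ge0_integralZl_EFin ?sqr_ge0//; last 1 first.
- by apply/measurable_EFinP.
have itv_len : leb `]t n, t n.+1]%classic = (t n.+1 - t n)%:E.
  rewrite lebesgue_measure_itv/= lte_fin.
  by have := tS n (ltnSn n); rewrite le_eqVlt => /orP[/eqP ->|->]; rewrite ?ltxx ?subrr.
rewrite integral_indic// setIT [RHS]EFinM; congr (_ * _)%E.
exact: itv_len.
Qed.

End step_isometry.

(** * Gaussian and independent increments of Brownian motion *)

Section brownian_increments.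
Context {R : realType} {d} {Omega : measurableType d} (P : probability Omega R).
Variables (T : R) (W : R -> {RV P >-> R}).
Hypothesis bm : brownian_motion T W.
Implicit Types (t c : nat -> R) (F : (R -> R) -> R).

Lemma gen_preimage (G : set (set Omega)) (f : Omega -> R) (A : set R) :
  measurable_fun [set: g_sigma_algebraType G] f -> measurable A -> <<s G >> (f @^-1` A).
Proof. by move=> mf mA; have := mf measurableT A mA; rewrite setTI. Qed.

Lemma measurable_block n (X : 'I_n -> Omega -> R) (D : pred nat) (k : 'I_n) :
  D k -> measurable_fun [set: g_sigma_algebraType (block_events X D)] (X k).
Proof.
move=> Dk _ A mA; rewrite setTI; apply: sub_sigma_algebra.
by exists k, A.
Qed.

Let incr t (k : nat) (w : Omega) : R := W (t k.+1) w - W (t k) w.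

Lemma measurable_increment (s s' : R) :
  measurable_fun [set: Omega] (fun w => W s w - W s' w).
Proof. exact: measurable_funB. Qed.

Lemma independent_increment_blocks n t (D : pred nat) : subdivision 0 T n t ->
  independent_systems P <<s block_events (fun i : 'I_n => incr t i) D >>
    <<s block_events (fun i : 'I_n => incr t i) (predC D) >>.
Proof.
move=> sub; apply: independent_blocks; last exact: (bm_indep bm sub).
by move=> k; exact: measurable_increment.
Qed.

Lemma gaussian_increment n t k : subdivision 0 T n t -> (k < n)%N ->
  centred_gaussian P (incr t k) (t k.+1 - t k).
Proof.
move=> sub kn A mA; have [_ tS _] := sub.
have /andP[tk0 _] := subdivision_itv sub (ltnW kn).
have /andP[_ tkT] := subdivision_itv sub kn.
(* [bm_normal] concerns s < t; coinciding times give the point mass at 0. *)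
rewrite /gaussian_law subr_eq0; have := tS k kn; rewrite le_eqVlt => /orP[/eqP tt|tt].
  rewrite -tt eqxx diracE; case: (boolP (0 \in A)) => A0.
    rewrite (_ : _ @^-1` _ = setT) ?probability_setT//.
    by apply/seteqP; split => // w _ /=; rewrite /incr tt subrr; exact/set_mem.
  rewrite (_ : _ @^-1` _ = set0) ?measure0//.
  apply/seteqP; split => // w /=; rewrite /incr tt subrr => /mem_set.
  by rewrite (negbTE A0).
by rewrite gt_eqF// (bm_normal bm).
Qed.

(** Induction on the number p of terms: the increments with index below p and the one with index p
    lie in complementary blocks, so the partial sum and the new term are independent. *)
Lemma gaussian_increment_sum n t c : subdivision 0 T n t ->
  centred_gaussian P (fun w => increment_sum n t c (fun s => W s w))
    (\sum_(i < n) c i ^+ 2 * (t i.+1 - t i)).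
Proof.
move=> sub; have [_ tS _] := sub.
suff h p : (p <= n)%N ->
    centred_gaussian P (fun w => increment_sum p t c (fun s => W s w))
      (\sum_(i < p) c i ^+ 2 * (t i.+1 - t i)) by exact: h.
elim: p => [_|p IH pn].
  rewrite big_ord0 => A mA; rewrite /gaussian_law eqxx diracE.
  case: (boolP (0 \in A)) => A0.
    rewrite (_ : _ @^-1` _ = setT) ?probability_setT//.
    by apply/seteqP; split => // w _ /=; rewrite /increment_sum big_ord0; exact/set_mem.
  rewrite (_ : _ @^-1` _ = set0) ?measure0//.
  apply/seteqP; split => // w /=; rewrite /increment_sum big_ord0 => /mem_set.
  by rewrite (negbTE A0).
rewrite big_ord_recr/= (_ : (fun w => _) = fun w =>
    increment_sum p t c (fun s => W s w) + c p * incr t p w); last first.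
  by apply/funext => w; rewrite /increment_sum big_ord_recr.
have tk0 k : (k < n)%N -> 0 <= t k.+1 - t k by move=> kn; rewrite subr_ge0 tS.
have mS q : measurable_fun [set: Omega] (fun w => increment_sum q t c (fun s => W s w)).
  apply: measurable_sum => i; apply: measurable_funM => //.
  exact: measurable_increment.
apply: centred_gaussianD => //.
- by apply: measurable_funM => //; exact: measurable_increment.
- apply: sumr_ge0 => i _; rewrite mulr_ge0 ?sqr_ge0// tk0//.
  by rewrite (leq_trans (ltn_ord i))// ltnW.
- by rewrite mulr_ge0 ?sqr_ge0// tk0.
- exact: IH (ltnW pn).
- by apply: centred_gaussianZ; [exact: tk0|exact: gaussian_increment sub pn].
move=> A B mA mB.
apply: (@independent_increment_blocks n t (fun k => k < p)%N sub).
- apply: gen_preimage => //; apply: measurable_sum => i.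
  apply: measurable_funM => //; have i_n : (i < n)%N.
    by rewrite (ltn_trans (ltn_ord i)).
  exact: (@measurable_block n (fun i : 'I_n => incr t i) _ (Ordinal i_n) (ltn_ord i)).
- apply: gen_preimage => //; apply: measurable_funM => //.
  apply: (@measurable_block n (fun i : 'I_n => incr t i) _ (Ordinal pn)).
  by rewrite /= ltnn.
Qed.

Lemma measurable_step_integral F a b : step_functional a b F ->
  measurable_fun [set: Omega] (fun w => F (fun s => W s w)).
Proof.
move=> [n [t [c [_ FE]]]].
rewrite (_ : (fun w => _) = fun w => increment_sum n t c (fun s => W s w)).
  apply: measurable_sum => i; apply: measurable_funM => //.
  exact: measurable_increment.
by apply/funext => w; rewrite FE.
Qed.

(** The same v is the squared norm of the integrand and the variance of the integral: the isometry
    for step functions. *)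
Lemma gaussian_step_integral F : step_functional 0 T F ->
  exists2 v : R, 0 <= v & sqint (@lebesgue_measure R) (fun x => F (upto x)) = v%:E /\
    centred_gaussian P (fun w => F (fun s => W s w)) v.
Proof.
move=> [n [t [c [sub FE]]]].
exists (\sum_(i < n) c i ^+ 2 * (t i.+1 - t i)).
  apply: sumr_ge0 => i _; rewrite mulr_ge0 ?sqr_ge0// subr_ge0.
  by have [_ tS _] := sub; exact: tS.
have -> : (fun x => F (upto x)) = (fun x => increment_sum n t c (upto x)).
  by apply/funext => x; rewrite FE.
have -> : (fun w => F (fun s => W s w)) = (fun w => increment_sum n t c (fun s => W s w)).
  by apply/funext => x; rewrite FE.
by split; [exact: sqint_increment_sum sub|exact: gaussian_increment_sum].
Qed.

(** Increments are taken from a reference time r: 0 for the past and u for the future. *)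
Definition increment_events (r a b : R) : set (set Omega) :=
  [set C | exists (v : R) (A : set R),
    [/\ a <= v <= b, measurable A & C = (fun w => W v w - W r w) @^-1` A]].

(** Such an event involves finitely many times and lies in every generated sigma-algebra that makes
    those increments measurable, in particular in a block of a subdivision. *)
Lemma finite_intersection_increments r a b E :
  finite_intersection (increment_events r a b) E ->
  exists s : seq R, (forall v, v \in s -> a <= v <= b) /\
    forall G : set (set Omega),
      (forall v, v \in s -> measurable_fun [set: g_sigma_algebraType G]
         (fun w => W v w - W r w)) -> <<s G >> E.
Proof.
elim=> [|_ B [v [A [vab mA ->]]] _ [s [sab sG]]].
  exists [::]; split => // G _.
  exact: (@measurableT _ (g_sigma_algebraType G)).
exists (v :: s); split.
  by move=> v'; rewrite inE => /orP[/eqP ->//|]; exact: sab.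
move=> G vG; apply: (@measurableI _ (g_sigma_algebraType G)).
  by apply: gen_preimage => //; apply: vG; rewrite mem_head.
by apply: sG => v' v's; apply: vG; rewrite inE v's orbT.
Qed.

(* Sorting all the times involved in two finite intersections, together with 0
   and u, gives one subdivision whose increments before and after u form two
   disjoint blocks. *)
Lemma independent_past_future (u : R) : 0 <= u <= T ->
  independent_systems P <<s increment_events 0 0 u >> <<s increment_events u u T >>.
Proof.
move=> /andP[u0 uT]; have im r a b : increment_events r a b `<=` measurable.
  move=> _ [v [A [_ mA ->]]]; apply: measurable_preimage => //.
  exact: measurable_increment.
apply: independent_systems_gen => // E1 E2.
move=> /finite_intersection_increments[s1 [s1u s1G]].
move=> /finite_intersection_increments[s2 [s2u s2G]].
pose L := sort <=%R (0 :: u :: s1 ++ s2).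
have memL x : (x \in L) = [|| x == 0, x == u, x \in s1 | x \in s2].
  by rewrite mem_sort !inE mem_cat.
have L0T x : x \in L -> 0 <= x <= T.
  rewrite memL => /or4P[/eqP ->|/eqP ->|/s1u/andP[x0 xu]|/s2u/andP[ux xT]].
  - by rewrite lexx (le_trans u0).
  - by rewrite u0.
  - by rewrite x0 (le_trans xu).
  - by rewrite xT andbT (le_trans u0).
have srt : sorted <=%R L by apply: sort_sorted; exact: le_total.
have szL : (0 < size L)%N by rewrite size_sort.
pose t i := nth 0 L i; pose n := (size L).-1.
have nE : n.+1 = size L by rewrite /n prednK.
have tin i : (i <= n)%N -> t i \in L by move=> i_n; rewrite mem_nth// -nE.
have mono i j : (i <= j)%N -> (j <= n)%N -> t i <= t j.
  move=> ij jn; apply: (sorted_leq_nth le_trans lexx) => //; rewrite inE -nE ltnS//.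
  exact: leq_trans jn.
have sub : subdivision 0 T n t.
  split; first by have /andP[] := L0T _ (tin 0%N (leq0n _)).
    by move=> i i_n; apply: mono.
  by have /andP[] := L0T _ (tin n (leqnn _)).
have idx x : x \in L -> (index x L <= n)%N /\ t (index x L) = x.
  by move=> xL; rewrite -ltnS nE index_mem xL /t nth_index.
(* [L] may contain repetitions; [index] returns the first occurrence, so equal points have equal
   indices. *)
have idx_le x y : x \in L -> y \in L -> x <= y -> (index x L <= index y L)%N.
  move=> xL yL xy; rewrite leqNgt; apply/negP => yx.
  have [xn tx] := idx x xL; have [yn ty] := idx y yL.
  have : y <= x by rewrite -tx -ty; apply: mono => //; exact: ltnW.
  by move=> yx'; move: yx; rewrite (le_anti (introT andP (conj xy yx'))) ltnn.
pose X (i : 'I_n) := incr t i.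
have tele x y (D : pred nat) : x \in L -> y \in L -> x <= y ->
    (forall k, (index x L <= k < index y L)%N -> D k) ->
    measurable_fun [set: g_sigma_algebraType (block_events X D)] (fun w => W y w - W x w).
  move=> xL yL xy Dk; have ixy := idx_le _ _ xL yL xy.
  have [xn tx] := idx x xL; have [yn ty] := idx y yL.
  rewrite (_ : (fun w => _) = fun w => \sum_(k < n | (index x L <= k < index y L)%N) X k w).
    under eq_fun do rewrite big_mkcond/=.
    apply: measurable_sum => k; case: (boolP (index x L <= k < index y L)%N) => [/Dk Dk'|_];
      last exact: measurable_cst.
    exact: measurable_block.
  apply/funext => w; rewrite -{1}tx -{1}ty -(telescope_sumr (fun k => W (t k) w))//.
  rewrite (big_nat_widen _ _ _ _ _ yn) (big_nat_widenl _ 0)//= big_mkord.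
  by apply: eq_bigl => k; rewrite andbC.
have uL : u \in L by rewrite memL eqxx orbT.
have zL : 0 \in L by rewrite memL eqxx.
apply: (@independent_increment_blocks n t (fun k => k < index u L)%N sub).
- apply: s1G => v vs; have /andP[v0 vu] := s1u v vs.
  have vL : v \in L by rewrite memL vs !orbT.
  apply: tele => // k /andP[_ kv]; apply: leq_trans kv _.
  exact: idx_le.
- apply: s2G => v vs; have /andP[uv vT] := s2u v vs.
  have vL : v \in L by rewrite memL vs !orbT.
  by apply: tele => // k /andP[uk _] /=; rewrite -leqNgt.
Qed.

End brownian_increments.

(** * Wiener integrals *)

Section wiener_integrals.
Context {R : realType} {d} {Omega : measurableType d} (P : probability Omega R).
Variables (T : R) (W : R -> {RV P >-> R}).
Hypothesis bm : brownian_motion T W.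
Local Notation leb := (@lebesgue_measure R).
Implicit Types (a b u : R) (f g : R -> R) (X Y : Omega -> R) (F : (R -> R) -> R).
Local Notation path w := (fun s => W s w).

(* The global form of [wiener_integral]: [f] is defined on the whole line and
   only the subdivisions remember the interval [a, b]. *)
Definition wint a b f X : Prop :=
  [/\ measurable_fun [set: R] f, (sqint leb f < +oo)%E,
      measurable_fun [set: Omega] X &
      exists F : nat -> (R -> R) -> R, [/\ forall k, step_functional a b (F k),
        (fun k => sqint leb (fun x => f x - F k (upto x))) @ \oo --> 0%E &
        (fun k => sqint P (fun w => X w - F k (path w))) @ \oo --> 0%E]].

Lemma wint_widen a b a' b' f X : a' <= a -> b <= b' -> wint a b f X -> wint a' b' f X.
Proof.
move=> aa bb [mf foo mX [F [sF fF XF]]]; split => //; exists F; split => // k.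
exact: step_functional_widen (sF k).
Qed.

Lemma wint_lincomb a b f g X Y (k l : R) : wint a b f X -> wint a b g Y ->
  wint a b (fun x => k * f x + l * g x) (fun w => k * X w + l * Y w).
Proof.
move=> [mf foo mX [F [sF fF XF]]] [mg goo mY [G [sG gG YG]]].
have mZ d' (S : measurableType d') (c : R) (h : S -> R) :
  measurable_fun [set: S] h -> measurable_fun [set: S] (fun x => c * h x).
  by move=> mh; exact: measurable_funM.
have mFx i : measurable_fun [set: R] (fun x => F i (upto x)).
  exact: measurable_step_fun (sF i).
have mGx i : measurable_fun [set: R] (fun x => G i (upto x)).
  exact: measurable_step_fun (sG i).
have mFw i : measurable_fun [set: Omega] (fun w => F i (path w)).
  exact: (measurable_step_integral W (sF i)).
have mGw i : measurable_fun [set: Omega] (fun w => G i (path w)).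
  exact: (measurable_step_integral W (sG i)).
split.
- by apply: measurable_funD; exact: mZ.
- by apply: sqintD_lty; try exact: mZ; exact: sqintZ_lty.
- by apply: measurable_funD; exact: mZ.
exists (fun i H => k * F i H + l * G i H); split.
- by move=> i; exact: step_functional_lincomb.
- apply: (@cvg_sqintD R _ _ leb (fun x => k * f x) (fun x => l * g x)
    (fun i x => k * F i (upto x)) (fun i x => l * G i (upto x))).
  + exact: mZ.
  + exact: mZ.
  + by move=> i; exact: (mZ _ _ _ _ (mFx i)).
  + by move=> i; exact: (mZ _ _ _ _ (mGx i)).
  + exact: (@cvg_sqintZ R _ _ leb k f (fun i x => F i (upto x))).
  + exact: (@cvg_sqintZ R _ _ leb l g (fun i x => G i (upto x))).
- apply: (@cvg_sqintD R _ _ P (fun x => k * X x) (fun x => l * Y x)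
    (fun i w => k * F i (path w)) (fun i w => l * G i (path w))).
  + exact: mZ.
  + exact: mZ.
  + by move=> i; exact: (mZ _ _ _ _ (mFw i)).
  + by move=> i; exact: (mZ _ _ _ _ (mGw i)).
  + exact: (@cvg_sqintZ R _ _ P k X (fun i w => F i (path w))).
  + exact: (@cvg_sqintZ R _ _ P l Y (fun i w => G i (path w))).
Qed.

Lemma wint0 a b : a <= b -> wint a b (fun=> 0) (fun=> 0).
Proof.
move=> ab; have sq0 d' (S : measurableType d') (mu : {measure set S -> \bar R}) :
    sqint mu (fun=> 0 : R) = 0%E.
  by rewrite /sqint; under eq_integral do rewrite expr0n/=; exact: integral0.
split => //; first by rewrite sq0 ltry.
exists (fun _ _ => 0); split.
- move=> k; exists 0%N, (fun=> a), (fun=> 0); split; first by split.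
  by move=> G; rewrite /increment_sum big_ord0.
- by under eq_fun do [under [X in sqint _ X]eq_fun do rewrite subrr; rewrite sq0]; exact: cvg_cst.
- by under eq_fun do [under [X in sqint _ X]eq_fun do rewrite subrr; rewrite sq0]; exact: cvg_cst.
Qed.

Lemma wint_sum a b n (k : 'I_n -> R) (f : 'I_n -> R -> R) (X : 'I_n -> Omega -> R) :
  a <= b -> (forall i, wint a b (f i) (X i)) ->
  wint a b (fun x => \sum_(i < n) k i * f i x) (fun w => \sum_(i < n) k i * X i w).
Proof.
move=> ab; elim: n k f X => [|n IH] k f X fX.
  under eq_fun do rewrite big_ord0; under [X in wint _ _ _ X]eq_fun do rewrite big_ord0.
  exact: wint0.
under eq_fun do rewrite big_ord_recr/= -[X in X + _]mul1r.
under [X in wint _ _ _ X]eq_fun do rewrite big_ord_recr/= -[X in X + _]mul1r.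
by apply: wint_lincomb => //; exact: IH.
Qed.

Lemma eq_ae_wint a b f X X' : measurable_fun [set: Omega] X' ->
  {ae P, forall w, X w = X' w} -> wint a b f X -> wint a b f X'.
Proof.
move=> mX' XX' [mf foo mX [F [sF fF XF]]]; split => //; exists F; split => //.
rewrite (_ : (fun k => _) = (fun k => sqint P (fun w => X w - F k (path w)))) //.
apply/funext => k; have mF := measurable_step_integral W (sF k).
apply: eq_ae_sqint; try exact: measurable_funB.
by apply: filterS XX' => w ->.
Qed.

(** A subsequence of the step integrals converges almost surely, and their variances are the squared
    norms of the step functions, which converge to that of f. *)
Lemma wint_gaussian a b f X : 0 <= a -> b <= T -> wint a b f X ->
  centred_gaussian P X (fine (sqint leb f)).
Proof.
move=> a0 bT [mf foo mX [F [sF fF XF]]].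
have sF' k : step_functional 0 T (F k) by exact: step_functional_widen (sF k).
have mF k := measurable_step_integral W (sF k).
have mFx k := measurable_step_fun (sF k).
have /choice[v vP] : forall k, exists v : R, 0 <= v /\
    sqint leb (fun x => F k (upto x)) = v%:E /\
    centred_gaussian P (fun w => F k (path w)) v.
  by move=> k; have [v v0 [h1 h2]] := gaussian_step_integral bm (sF' k); exists v.
have [phi phi_ge ae_cvg] := ae_cvg_subsequence mX mF XF.
have fE : sqint leb f = (fine (sqint leb f))%:E.
  by rewrite fineK// ge0_fin_numE// sqint_ge0.
have vlim : v @ \oo --> fine (sqint leb f).
  have := @cvg_sqint R _ _ leb f (fun k x => F k (upto x)) mf mFx foo fF; rewrite fE.
  have -> : (fun k => sqint leb (fun x => F k (upto x))) = EFin \o v.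
    by apply/funext => k; have [_ [->]] := vP k.
  by move=> /fine_cvgP[_].
apply: (@centred_gaussian_cvg _ _ _ P (fun j w => F (phi j) (path w)) X (v \o phi)) => //.
- by move=> j; have [] := vP (phi j).
- by rewrite fine_ge0// sqint_ge0.
- by move=> j; have [_ []] := vP (phi j).
apply: cvg_comp vlim; apply/cvgnyPge => N; exists N => // j /= Nj.
exact: leq_trans (phi_ge j).
Qed.

Lemma wint_isometry a b f X : 0 <= a -> b <= T -> wint a b f X ->
  sqint P X = sqint leb f.
Proof.
move=> a0 bT fX; have [_ foo mX _] := fX.
rewrite (sqint_gaussian mX _ (wint_gaussian a0 bT fX)) ?fine_ge0 ?sqint_ge0//.
by rewrite fineK// ge0_fin_numE// sqint_ge0.
Qed.

Lemma wint_mean0 a b f X : 0 <= a -> b <= T -> wint a b f X ->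
  (\int[P]_w (X w)%:E = 0)%E.
Proof.
move=> a0 bT fX; have [_ foo mX _] := fX.
by apply: integral_gaussian0 (wint_gaussian a0 bT fX); rewrite ?fine_ge0 ?sqint_ge0.
Qed.

Lemma wint_lty a b f X : 0 <= a -> b <= T -> wint a b f X -> (sqint P X < +oo)%E.
Proof. by move=> a0 bT fX; rewrite (wint_isometry a0 bT fX); have [] := fX. Qed.

(** Polarisation of the isometry applied to f + g; all terms are finite and can be cancelled. *)
Lemma wint_covariance a b f g X Y : 0 <= a -> b <= T ->
  wint a b f X -> wint a b g Y ->
  (\int[P]_w (X w * Y w)%R%:E = \int[leb]_x (f x * g x)%R%:E)%E.
Proof.
move=> a0 bT fX gY; have [mf foo mX _] := fX; have [mg goo mY _] := gY.
have Xoo := wint_lty a0 bT fX; have Yoo := wint_lty a0 bT gY.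
have := wint_isometry a0 bT (wint_lincomb 1 1 fX gY).
under eq_fun do rewrite !mul1r; under [X in _ = sqint _ X]eq_fun do rewrite !mul1r.
rewrite !sqintD// (wint_isometry a0 bT fX) (wint_isometry a0 bT gY).
have ifin d' (S : measurableType d') (mu : {measure set S -> \bar R}) (h h' : S -> R) :
    measurable_fun setT h -> measurable_fun setT h' ->
    (sqint mu h < +oo)%E -> (sqint mu h' < +oo)%E ->
    (\int[mu]_x (h x * h' x)%R%:E)%E \is a fin_num.
  by move=> *; apply: integrable_fin_num => //; exact: integrable_mul_sqr.
have i1 := ifin _ _ P X Y mX mY Xoo Yoo.
have i2 := ifin _ _ leb f g mf mg foo goo.
have s1 : sqint leb f \is a fin_num by rewrite ge0_fin_numE// sqint_ge0.
have s2 : sqint leb g \is a fin_num by rewrite ge0_fin_numE// sqint_ge0.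
rewrite -(fineK i1) -(fineK i2) -(fineK s1) -(fineK s2) -!EFinM -!EFinD => -[h].
by congr EFin; lra.
Qed.

(** The difference is an integral of 0, so the isometry gives it norm 0. *)
Lemma wint_unique a b f X X' : 0 <= a -> b <= T -> wint a b f X -> wint a b f X' ->
  {ae P, forall w, X w = X' w}.
Proof.
move=> a0 bT fX fX'; have dX := wint_lincomb 1 (-1) fX fX'.
have [_ _ mD _] := dX; have := wint_isometry a0 bT dX.
have -> : sqint leb (fun x => 1 * f x + -1 * f x) = 0%E.
  rewrite /sqint (eq_integral (cst 0%E)) ?integral0// => x _.
  by rewrite mul1r mulN1r subrr expr0n.
move=> /(sqint_eq0 mD); apply: filterS => w /=.
by rewrite mul1r mulN1r => /subr0_eq.
Qed.

(** The truncated step integrals are Cauchy in L^2(P), since by the isometry their distances are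
    those of the truncated integrands; Y is their limit. The remainder X - Y is then the limit of
    the complementary truncations. *)
Lemma wint_split a b u f X : 0 <= a -> b <= T -> a <= u <= b -> wint a b f X ->
  exists Y, wint a u (fun x => (x <= u)%R%:R * f x) Y /\
    wint u b (fun x => (u < x)%R%:R * f x) (fun w => X w - Y w).
Proof.
move=> a0 bT /andP[au ub] [mf foo mX [F [sF fF XF]]].
pose Fm k H := F k (fun s => H (Num.min s u)).
pose FM k H := F k (fun s => H (Num.max s u)).
have sm k : step_functional a u (Fm k) by exact: step_functional_min.
have sM k : step_functional u b (FM k) by exact: step_functional_max.
have mle : measurable_fun [set: R] (fun x : R => (x <= u)%R%:R : R).
  exact: measurable_upto.
have mlt : measurable_fun [set: R] (fun x : R => (u < x)%R%:R : R).
  rewrite (_ : (fun x => _) = fun x => 1 - (x <= u)%R%:R); first exact: measurable_funB.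
  by apply/funext => x; rewrite ltNge; case: (x <= u); rewrite ?subrr ?subr0.
have mFx k := measurable_step_fun (sF k).
have cut (p : R -> bool) (mp : measurable_fun [set: R] (fun x => (p x)%:R : R)) (h : R -> R) :
    measurable_fun setT h -> (sqint leb (fun x => (p x)%:R * h x)%R <= sqint leb h)%E.
  move=> mh; apply: sqint_le => //; first exact: measurable_funM.
  by move=> x; rewrite normrM; case: (p x); rewrite ?normr1 ?mul1r// normr0 mul0r.
have cutlim (p : R -> bool) (mp : measurable_fun [set: R] (fun x => (p x)%:R : R))
    (G : nat -> (R -> R) -> R) : (forall k x, G k (upto x) = (p x)%:R * F k (upto x)) ->
    (fun k => sqint leb (fun x => (p x)%:R * f x - G k (upto x))) @ \oo --> 0%E.
  move=> GE; apply: squeeze_cvge (cvg_cst 0%E) fF; apply: nearW => k.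
  rewrite sqint_ge0/=; under eq_fun do rewrite GE -mulrBr.
  by apply: cut => //; exact: measurable_funB.
have mmw k := measurable_step_integral W (sm k).
have cauchy (e : R) : 0 < e -> exists N, forall k l, (N <= k)%N -> (N <= l)%N ->
    (sqint P (fun w => Fm k (path w) - Fm l (path w))%R <= e%:E)%E.
  move=> e0; have e4 : 0 < e / 4 by rewrite divr_gt0.
  have [N NP] := (cvge0P (fun k => sqint_ge0 leb _)).1 fF _ e4.
  exists N => k l Nk Nl.
  have sd : step_functional 0 T (fun H => 1 * Fm k H + -1 * Fm l H).
    apply: (@step_functional_widen _ a u) => //; first exact: le_trans bT.
    exact: step_functional_lincomb.
  have [v v0 [lv gv]] := gaussian_step_integral bm sd.
  have := sqint_gaussian (measurable_step_integral W sd) v0 gv.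
  rewrite -lv; under eq_fun do rewrite mul1r mulN1r; move=> ->.
  rewrite (_ : (fun x => _) =
      (fun x => (x <= u)%R%:R * (F k (upto x) - F l (upto x)))); last first.
    apply/funext => x; rewrite mul1r mulN1r /Fm !(step_functional_upto_min _ _ (sF _)).
    by rewrite mulrBr.
  apply: le_trans (cut _ mle _ (measurable_funB (mFx k) (mFx l))) _.
  rewrite (_ : sqint leb _ =
      sqint leb (fun x => (f x - F l (upto x)) - (f x - F k (upto x)))); last first.
    by apply: eq_integral => x _ /=; congr ((_ ^+ 2)%:E); ring.
  apply: le_trans (sqintB_le leb (measurable_funB mf (mFx l)) (measurable_funB mf (mFx k))) _.
  apply: (@le_trans _ _ (2%:E * (e / 4)%:E + 2%:E * (e / 4)%:E)%E).
    by apply: leeD; apply: lee_wpmul2l => //; exact: NP.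
  by rewrite -!EFinM -EFinD lee_fin; lra.
have [phi] := @sqint_complete R _ _ P (fun k w => Fm k (path w)) mmw cauchy.
set Y := (fun w => _) => -[mY Ylim]; exists Y; split.
- split => //.
  + exact: measurable_funM.
  + by apply: le_lt_trans foo; exact: cut.
  exists Fm; split => //.
  by apply: (cutlim (fun x => x <= u)) => // k x; exact: (step_functional_upto_min _ _ (sF k)).
- split => //.
  + exact: measurable_funM.
  + by apply: le_lt_trans foo; exact: (cut (fun x => u < x)).
  + exact: measurable_funB.
  exists FM; split => //.
    by apply: (cutlim (fun x => u < x)) => // k x; exact: (step_functional_upto_max _ _ (sF k)).
  have mNw k : measurable_fun [set: Omega] (fun w => -1 * Fm k (path w)).
    exact: measurable_funM.
  have -> : (fun k => sqint P (fun w => X w - Y w - FM k (path w))) =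
      (fun k => sqint P (fun w => (X w + -1 * Y w)
                                  - (F k (path w) + -1 * Fm k (path w)))).
    apply/funext => k; apply: eq_integral => w _; congr ((_ ^+ 2)%:E).
    by rewrite -(step_functional_minDmax u (path w) (sF k)) /Fm /FM; ring.
  apply: (@cvg_sqintD R _ _ P X (fun w => -1 * Y w) (fun k w => F k (path w))
    (fun k w => -1 * Fm k (path w))) => //.
  + exact: measurable_funM.
  + by move=> k; exact: (measurable_step_integral W (sF k)).
  + exact: (@cvg_sqintZ R _ _ P (-1) Y (fun k w => Fm k (path w))).
Qed.

(** X itself need not be measurable for the increments. The upper limit of a subsequence of step
    integrals is, and it equals X almost surely. *)
Lemma wint_adapted a b f X : wint a b f X ->
  exists2 X' : Omega -> R,
    measurable_fun [set: g_sigma_algebraType (increment_events W a a b)] X' &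
    {ae P, forall w, X w = X' w}.
Proof.
move=> [mf foo mX [F [sF fF XF]]].
have mF k := measurable_step_integral W (sF k).
have [phi _ ae_cvg] := ae_cvg_subsequence mX mF XF.
exists (fun w => fine (limn_esup (fun j => (F (phi j) (path w))%:E))).
  apply: measurableT_comp; first exact: fine_measurable.
  apply: (@measurable_fun_limn_esup _ (g_sigma_algebraType (increment_events W a a b)))=> j.
  apply/measurable_EFinP; have [n [t [c [sub FE]]]] := sF (phi j).
  rewrite (_ : (fun w => _) = fun w => \sum_(i < n) c i *
      ((W (t i.+1) w - W a w) - (W (t i) w - W a w))).
    apply: measurable_sum => i; apply: measurable_funM => //.
    have mt k : (k <= n)%N -> measurable_fun
        [set: g_sigma_algebraType (increment_events W a a b)] (fun w => W (t k) w - W a w).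
      move=> kn _ A mA; rewrite setTI; apply: sub_sigma_algebra.
      by exists (t k), A; split => //; exact: (subdivision_itv sub).
    by apply: measurable_funB; apply: mt => //; exact: ltnW.
  apply/funext => w; rewrite FE; apply: eq_bigr => i _; ring.
apply: filterS ae_cvg => w Xw.
have : (EFin \o (fun j => F (phi j) (path w))) @ \oo --> (X w)%:E.
  by apply: cvg_EFin => //; exact: nearW.
by move=> /cvg_limn_einf_sup[_ /= ->].
Qed.

End wiener_integrals.

(** * Equality modulo null sets *)

Section equality_mod_null_sets.
Context {R : realType} d {T : measurableType d} (P : probability T R).
Implicit Types (A B C D : set T) (F G : set (set T)).

(** Negligibility makes sense for arbitrary sets, so the calculus below requires no
    measurability. *)
Definition eqset_null A B : Prop := P.-negligible ((A `\` B) `|` (B `\` A)).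

Lemma eqset_nullP A B : measurable A -> measurable B ->
  eqset_null A B <-> P ((A `\` B) `|` (B `\` A)) = 0%E.
Proof.
by move=> mA mB; apply: negligibleP; apply: measurableU; exact: measurableD.
Qed.

Lemma eqset_null_refl A : eqset_null A A.
Proof. by rewrite /eqset_null setDv setU0; exact: negligible_set0. Qed.

Lemma eqset_null_trans A B C : eqset_null A B -> eqset_null B C -> eqset_null A C.
Proof.
move=> AB BC; apply: negligibleS (negligibleU AB BC) => x; rewrite /setU /setD /mkset/=.
by have [Bx|Bx] := pselect (B x); tauto.
Qed.

Lemma eqset_nullI A B C D : eqset_null A B -> eqset_null C D ->
  eqset_null (A `&` C) (B `&` D).
Proof.
move=> AB CD; apply: negligibleS (negligibleU AB CD) => x.
rewrite /setU /setD /setI /mkset/=.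
by have [Bx|Bx] := pselect (B x); have [Dx|Dx] := pselect (D x);
  have [Ax|Ax] := pselect (A x); tauto.
Qed.

Lemma eqset_nullC A B : eqset_null A B -> eqset_null (~` A) (~` B).
Proof.
apply: negligibleS => x; rewrite /setU /setD /setC /mkset/=.
by have [Bx|Bx] := pselect (B x); have [Ax|Ax] := pselect (A x); tauto.
Qed.

Lemma eqset_null_bigcup (A B : nat -> set T) :
  (forall n, eqset_null (A n) (B n)) -> eqset_null (\bigcup_n A n) (\bigcup_n B n).
Proof.
move=> AB; apply: negligibleS (negligible_bigcup AB) => x /=.
move=> [] [[n _ h] nh]; exists n => //; [left|right]; split => // h';
  by apply: nh; exists n.
Qed.

Lemma eqset_null_measure A B : measurable A -> measurable B ->
  eqset_null A B -> P A = P B.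
Proof.
move=> mA mB AB; have mAB := measurableD mA mB; have mBA := measurableD mB mA.
have /measure_negligible A0 : P.-negligible (A `\` B) by apply: negligibleS AB => x; left.
have /measure_negligible B0 : P.-negligible (B `\` A) by apply: negligibleS AB => x; right.
rewrite (measureDI P mA mB) (measureDI P mB mA) A0// B0//.
by rewrite !add0e setIC.
Qed.

Lemma eq_ae_eqset_null d' (T' : measurableType d') (f g : T -> T') (A : set T') :
  {ae P, forall x, f x = g x} -> eqset_null (f @^-1` A) (g @^-1` A).
Proof.
apply: negligibleS => x /= h fg; move: h; rewrite fg.
by move=> [[? []]|[? []]].
Qed.

(** Members are kept measurable so that the product rule can pass from their representatives to
    them. *)
Definition null_completion G : set (set T) :=
  [set A | measurable A /\ exists2 B, <<s G >> B & eqset_null A B].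

Lemma sigma_algebra_null_completion G : sigma_algebra setT (null_completion G).
Proof.
split.
- split; first exact: measurable0.
  by exists set0; [exact: sigma_algebra0|exact: eqset_null_refl].
- move=> A [mA [B GB AB]]; rewrite setTD; split; first exact: measurableC.
  by exists (~` B); [exact: sigma_algebraC|exact: eqset_nullC].
- move=> A GA; split; first by apply: bigcupT_measurable => n; have [] := GA n.
  have /choice[B BP] : forall n, exists B, <<s G >> B /\ eqset_null (A n) B.
    by move=> n; have [_ [B ? ?]] := GA n; exists B.
  exists (\bigcup_n B n); last by apply: eqset_null_bigcup => n; have [] := BP n.
  by apply: sigma_algebra_bigcup => n; have [] := BP n.
Qed.

Lemma null_completion_gen F G : F `<=` null_completion G -> <<s F >> `<=` null_completion G.
Proof. by apply: smallest_sub; exact: sigma_algebra_null_completion. Qed.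

Lemma null_completion_trans F G :
  <<s F >> `<=` null_completion G -> null_completion F `<=` null_completion G.
Proof.
move=> FG A [mA [B FB AB]]; split => //; have [_ [C GC BC]] := FG _ FB.
by exists C => //; exact: eqset_null_trans BC.
Qed.

Lemma null_completion_sub_mod_null F G : F `<=` measurable -> G `<=` measurable ->
  sub_mod_null P <<s F >> <<s G >> -> <<s F >> `<=` null_completion G.
Proof.
move=> Fm Gm FG A FA; have mA := gen_measurable Fm FA; split => //.
have [B GB AB] := FG _ FA; exists B => //.
by apply/eqset_nullP => //; exact: gen_measurable GB.
Qed.

Lemma independent_null_completion F G : F `<=` measurable -> G `<=` measurable ->
  independent_systems P <<s F >> <<s G >> ->
  independent_systems P (null_completion F) (null_completion G).
Proof.
move=> Fm Gm FG A B [mA [A' FA AA]] [mB [B' GB BB]].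
have mA' := gen_measurable Fm FA; have mB' := gen_measurable Gm GB.
rewrite (eqset_null_measure _ _ (eqset_nullI AA BB)); try exact: measurableI.
by rewrite FG// -(eqset_null_measure mA mA' AA) -(eqset_null_measure mB mB' BB).
Qed.

(* [g] is the infimum of the rationals [q] for which [x] lies in the chosen
   [G]-version of [f < q]. *)
Lemma measurable_null_completion F G (f : T -> R) :
  F `<=` measurable -> G `<=` measurable -> <<s F >> `<=` null_completion G ->
  measurable_fun [set: g_sigma_algebraType F] f ->
  exists2 g : T -> R, measurable_fun [set: g_sigma_algebraType G] g &
    {ae P, forall x, f x = g x}.
Proof.
move=> Fm Gm FG mf.
(* Indices that code no rational give the threshold 0, itself admissible. *)
pose q n : R := if unpickle n is Some r then ratr r else 0.
have /choice[D DP] : forall n, exists D, <<s G >> D /\ eqset_null (f @^-1` `]-oo, q n[) D.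
  move=> n; have : <<s F >> (f @^-1` `]-oo, q n[).
    by have := mf measurableT `]-oo, q n[%classic; rewrite setTI; apply.
  by move=> /FG[_ [D GD fD]]; exists D.
pose g_ n x : \bar R := if x \in D n then (q n)%:E else +oo%E.
exists (fun x => fine (einfs (fun n => g_ n x) 0%N)).
  apply: measurableT_comp; first exact: fine_measurable.
  apply: (@measurable_fun_einfs _ (g_sigma_algebraType G) R setT g_) => n.
  apply: measurable_fun_ifT => //.
  apply: (@measurable_fun_bool _ (g_sigma_algebraType G) setT _ true).
  rewrite setTI (_ : _ @^-1` _ = D n); first by have [] := DP n.
  by apply/seteqP; split => x /=; [move=> /set_mem|move=> /mem_set].

have : P.-negligible (\bigcup_n
    ((f @^-1` `]-oo, q n[ `\` D n) `|` (D n `\` f @^-1` `]-oo, q n[))).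
  by apply: negligible_bigcup => n; have [_] := DP n.
apply: negligibleS => x; apply: contra_notP => nD.
have Dq n : D n x <-> f x < q n.
  split => [Dx|fq]; apply: contrapT => h; apply: nD; exists n => //.
    by right; split => //=; rewrite in_itv.
  by left; split => //=; rewrite in_itv.
suff h : einfs (fun n => g_ n x) 0%N = (f x)%:E.
  by rewrite /= -[RHS]/(fine (einfs (fun n => g_ n x) 0%N)) h.
apply/eqP; rewrite eq_le; apply/andP; split; last first.
  apply: le_ereal_inf_tmp => _ [n _ <-]; rewrite /g_; case: ifPn; last by rewrite leey.
  by rewrite inE => /Dq /ltW; rewrite lee_fin.
apply/lee_addgt0Pr => e e0.
have /rat_in_itvoo[r] : f x < f x + e by rewrite ltrDl.
rewrite in_itv/= => /andP[fr re].
have qr : q (pickle r) = ratr r by rewrite /q pickleK.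
apply: (@le_trans _ _ (g_ (pickle r) x)).
  by apply: ereal_inf_lbound; exists (pickle r).
rewrite /g_ mem_set; last by apply/Dq; rewrite qr.
by rewrite qr -EFinD lee_fin ltW.
Qed.

End equality_mod_null_sets.

(** * The prediction law *)

Section wiener_integral_on_an_interval.
Context {R : realType} {d} {Omega : measurableType d} (P : probability Omega R).
Variable W : R -> {RV P >-> R}.
Local Notation leb := (@lebesgue_measure R).

Lemma restrict_sqr (A : set R) (f : R -> R) (x : R) :
  ((fun x => ((f x) ^+ 2)%:E) \_ A) x = (((f \_ A) x) ^+ 2)%:E.
Proof. by rewrite !patchE; case: ifP => // _; rewrite expr0n. Qed.

(** Step functions vanish off ]a, b], so extending f by 0 leaves the approximation errors
    unchanged. *)
Lemma wint_of_wiener_integral (a b : R) (f : R -> R) (X : Omega -> R) :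
  wiener_integral P W a b f X -> wint W a b (f \_ `[a, b]) X.
Proof.
move=> [mf foo mX [n [t [c [sub fs Xs]]]]].
have mf' : measurable_fun [set: R] (f \_ `[a, b]).
  exact/(measurable_restrictT _ _).1.
split => //.
  move: foo; rewrite integral_mkcond; congr (_ < _)%E.
  by apply: eq_integral => x _; rewrite restrict_sqr.
have sF k : step_functional a b (increment_sum (n k) (t k) (c k)).
  by exists (n k), (t k), (c k).
exists (fun k => increment_sum (n k) (t k) (c k)); split => //.
- suff -> : (fun k => sqint leb (fun x =>
      (f \_ `[a, b]) x - increment_sum (n k) (t k) (c k) (upto x))) =
    (fun k => \int[leb]_(x in `[a, b])
      ((f x - step_fun (n k) (t k) (c k) x) ^+ 2)%:E)%E by exact: fs.
  apply/funext => k; rewrite [RHS]integral_mkcond; apply: eq_integral => x _.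
  rewrite restrict_sqr; congr ((_ ^+ 2)%:E); rewrite !patchE.
  case: ifPn => [_|xab]; first by rewrite (step_fun_upto _ _ (sub k)).
  rewrite (step_functional_out (sF k)) ?subr0//; apply: contra xab => /andP[ax xb].
  by rewrite inE/= in_itv/= ltW.
- suff -> : (fun k => sqint P (fun w => X w - increment_sum (n k) (t k) (c k) (W^~ w))) =
    (fun k => 'E_P[fun w => ((X w - step_integral W (n k) (t k) (c k) w) ^+ 2)%R])%E
    by exact: Xs.
  by apply/funext => k; rewrite unlock.
Qed.

Lemma wiener_integral_of_wint (a b : R) (f g : R -> R) (X : Omega -> R) :
  (forall x, a <= x <= b -> g x = f x) -> wint W a b g X ->
  wiener_integral P W a b f X.
Proof.
move=> gf [mg goo mX [F [sF gF XF]]].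
have gfE x : x \in `[a, b]%classic -> g x = f x.
  by rewrite inE/= in_itv/= => /gf.
have mF k := measurable_step_fun (sF k).
split => //.
- by apply: (eq_measurable_fun g) => //; exact: measurable_funTS.
- have -> : (\int[leb]_(x in `[a, b]) ((f x) ^+ 2)%:E
      = \int[leb]_(x in `[a, b]) ((g x) ^+ 2)%:E)%E.
    by apply: eq_integral => x /gfE ->.
  apply: le_lt_trans goo; apply: ge0_subset_integral => //; first exact: measurable_sqr.
  by move=> x _; rewrite lee_fin sqr_ge0.
have /choice[n nP] := sF; have /choice[t tP] := nP; have /choice[c cP] := tP.
have sub k : subdivision a b (n k) (t k) by have [] := cP k.
have FE k G : F k G = increment_sum (n k) (t k) (c k) G by have [_] := cP k.
exists n, t, c; split => //.
- apply: squeeze_cvge (cvg_cst 0%E) gF; apply: nearW => k; apply/andP; split.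
    by apply: integral_ge0 => x _; rewrite lee_fin sqr_ge0.
  have -> : (\int[leb]_(x in `[a, b]) ((f x - step_fun (n k) (t k) (c k) x) ^+ 2)%R%:E
      = \int[leb]_(x in `[a, b]) ((g x - F k (upto x)) ^+ 2)%R%:E)%E.
    by apply: eq_integral => x /gfE ->; rewrite FE (step_fun_upto _ _ (sub k)).
  apply: ge0_subset_integral => //.
  - by apply: measurable_sqr; exact: (measurable_funB mg (mF k)).
  - by move=> x _; rewrite lee_fin sqr_ge0.
- suff -> : (fun k => 'E_P[fun w =>
      ((X w - step_integral W (n k) (t k) (c k) w) ^+ 2)%R])%E =
    (fun k => sqint P (fun w => X w - F k (W^~ w))) by exact: XF.
  apply/funext => k; rewrite unlock.
  by apply: eq_integral => w _; rewrite FE.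
Qed.

End wiener_integral_on_an_interval.

(** This puts all B_t on the common interval [0, T] and removes k_u after time u. *)
Lemma fbm_kernel_out {R : realType} n (H t v : R) :
  ~~ (0 < v < t) -> fbm_kernel n H t v = 0.
Proof.
by move=> /negbTE vt; case: n => [//|[|n]]; rewrite /= ?/mg_kernel vt.
Qed.

Section path_measurability.
Context {R : realType} {d} {Omega : measurableType d} (T : R).

Lemma measurable_path (X : Omega -> time T -> R) :
  (forall t, measurable_fun [set: Omega] (fun w => X w t)) ->
  measurable_fun [set: Omega] (X : Omega -> path_space T).
Proof.
move=> mX; apply: (@measurability _ _ _ (path_space T) setT X (@cylinder R T)) => //.
move=> _ [_ [t [A [mA ->]]] <-]; rewrite setTI.
exact: (measurable_preimage (mX t) mA).
Qed.

Lemma measurable_coordinate (t : time T) :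
  measurable_fun [set: path_space T] (fun x : path_space T => x t).
Proof.
by move=> _ A mA; rewrite setTI; apply: sub_sigma_algebra; exists t, A.
Qed.

End path_measurability.

(** * The prediction, the residual, and the conditional law *)

Section prediction_law.
Context {R : realType} {d} {Omega : measurableType d} (P : probability Omega R).
Variables (n : nat) (H T u : R) (W B : R -> {RV P >-> R}).
Hypothesis u_range : 0 <= u <= T.
Hypothesis bm : brownian_motion T W.
Hypothesis B_nfbm : nfbm n H T W B.
Hypothesis same_filtration : forall t : R, 0 <= t <= T ->
  eq_mod_null P <<s history W t >> <<s history B t >>.
Local Notation leb := (@lebesgue_measure R).
Local Notation k := (fbm_kernel n H).
Local Notation past := (increment_events W 0 0 u).
Local Notation future := (increment_events W u u T).

Let u0 : 0 <= u. Proof. by case/andP: u_range. Qed.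
Let uT : u <= T. Proof. by case/andP: u_range. Qed.

Lemma history_measurable (X : R -> {RV P >-> R}) t :
  history X t `<=` (@measurable _ Omega).
Proof. by move=> _ [v [A [_ mA ->]]]; exact: measurable_preimage. Qed.

Lemma measurable_history (X : R -> {RV P >-> R}) t v : 0 <= v <= t ->
  measurable_fun [set: g_sigma_algebraType (history X t)] (X v).
Proof.
by move=> vt _ A mA; rewrite setTI; apply: sub_sigma_algebra; exists v, A.
Qed.

Lemma increment_events_measurable r a b :
  increment_events W r a b `<=` (@measurable _ Omega).
Proof.
move=> _ [v [A [_ mA ->]]]; apply: measurable_preimage => //.
exact: measurable_funB.
Qed.

Lemma past_sub_history : <<s past >> `<=` null_completion P (history B u).
Proof.
have WB := null_completion_sub_mod_null (@history_measurable W u)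
  (@history_measurable B u) (same_filtration u_range).1.
move=> A pA; apply: WB; move: A pA; apply: sub_gen_sigma_algebra.
move=> _ [v [A [v0u mA ->]]]; apply: gen_preimage => //.
by apply: measurable_funB; apply: measurable_history; rewrite ?lexx.
Qed.

(** Two null corrections are composed: from the past of [B] to that of [W], and from W_v to W_v -
    W_0. *)
Lemma history_sub_past : <<s history B u >> `<=` null_completion P past.
Proof.
have BW := null_completion_sub_mod_null (@history_measurable B u)
  (@history_measurable W u) (same_filtration u_range).2.
move=> A /BW; apply: null_completion_trans; apply: null_completion_gen.
move=> _ [v [A' [v0u mA ->]]]; split; first exact: measurable_preimage.
exists ((fun w => W v w - W 0 w) @^-1` A').
  by apply: sub_sigma_algebra; exists v, A'.
apply: eq_ae_eqset_null; apply: filterS (bm_start bm) => w /= ->.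
by rewrite subr0.
Qed.

Lemma nfbm_wint t : 0 <= t <= T -> wint W 0 T (k t) (B t).
Proof.
move=> tT; have /andP[t0 tleT] := tT.
have := wint_of_wiener_integral (B_nfbm tT).
have -> : k t \_ `[0, t] = k t.
  apply/funext => x; rewrite patchE; case: ifPn => // xt.
  rewrite fbm_kernel_out//; apply: contra xt => /andP[x0 xt].
  by rewrite inE/= in_itv/= !ltW.
exact: wint_widen.
Qed.

Let increment_wint t : 0 <= t <= T ->
  wint W 0 T (fun x => k t x - k u x) (fun w => B t w - B u w).
Proof.
move=> tT; have := wint_lincomb 1 (-1) (nfbm_wint tT) (nfbm_wint u_range).
by congr wint; apply/funext => x; rewrite mul1r mulN1r.
Qed.

Let past_kernel t x : (x <= u)%R%:R * (k t x - k u x) =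
  ((fun x => k t x - k u x) \_ `[0, u]) x.
Proof.
rewrite patchE; case: ifPn => [|]; rewrite ?inE ?notin_setE/= in_itv/=.
  by move=> /andP[_ ->]; rewrite mul1r.
move=> /negP; rewrite negb_and -!ltNge => /orP[x0|ux].
  by rewrite !fbm_kernel_out ?subrr ?mulr0// negb_and -!leNgt ltW.
by rewrite leNgt ux mul0r.
Qed.

Let future_kernel t x : (u < x)%R%:R * (k t x - k u x) = (u < x)%R%:R * k t x.
Proof.
case: ltP => [ux|_]; rewrite ?mul0r// !mul1r [X in _ - X]fbm_kernel_out ?subr0//.
by rewrite negb_and -!leNgt (ltW ux) orbT.
Qed.

(** The part [Y] of the integral up to u is replaced by [Y1], measurable for the increments of [W],
    and then by [Y2], measurable for the past of [B]; each change is almost surely invisible. *)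
Lemma prediction_mean_exists : exists M, prediction_mean n H T W B u M.
Proof.
suff h t : exists m : Omega -> R, 0 <= t <= T ->
    measurable_fun [set: g_sigma_algebraType (history B u)] m /\
    wiener_integral P W 0 u (fun v => k t v - k u v) (fun w => m w - B u w).
  by have /choice[M MP] := h; exists M => t; exact: MP.
have [tT|tT] := boolP (0 <= t <= T); last by exists (fun=> 0).
have [Y [Yw _]] := wint_split bm (lexx 0) (lexx T) u_range (increment_wint tT).
have [Y1 mY1 YY1] := wint_adapted Yw.
have [Y2 mY2 Y12] := measurable_null_completion (@increment_events_measurable 0 0 u)
  (@history_measurable B u) past_sub_history mY1.
exists (fun w => B u w + Y2 w) => _; split.
  by apply: measurable_funD => //; apply: measurable_history; rewrite u0 lexx.
have mY2' : measurable_fun [set: Omega] Y2.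
  move=> _ A mA; rewrite setTI.
  by apply: (gen_measurable (@history_measurable B u)); exact: gen_preimage.
under [X in wiener_integral _ _ _ _ _ X]eq_fun do rewrite addrC addKr.
apply: (@wiener_integral_of_wint _ _ _ _ _ 0 u _
  (fun x => (x <= u)%R%:R * (k t x - k u x))).
  by move=> x /andP[_ ->]; rewrite mul1r.
apply: eq_ae_wint Yw => //.
by apply: filterS2 YY1 Y12 => w -> ->.
Qed.

Variable M : R -> Omega -> R.
Hypothesis M_mean : prediction_mean n H T W B u M.

Let Z t w := B t w - M t w.

Lemma measurable_mean t : 0 <= t <= T -> measurable_fun [set: Omega] (M t).
Proof.
move=> tT _ A mA; rewrite setTI.
apply: (gen_measurable (@history_measurable B u)); apply: gen_preimage => //.
by have [] := M_mean tT.
Qed.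

(** Z_t = (B_t - B_u) - (M_t - B_u), and by uniqueness M_t - B_u is a.s. the part up to u of the
    integral B_t - B_u, whichever version M_t is. *)
Lemma residual_wint t : 0 <= t <= T ->
  wint W u T (fun x => (u < x)%R%:R * k t x) (Z t).
Proof.
move=> tT; have [Y [Yw]] := wint_split bm (lexx 0) (lexx T) u_range (increment_wint tT).
rewrite (funext (future_kernel t)); apply: eq_ae_wint.
  by apply: measurable_funB => //; exact: measurable_mean.
have [_ /wint_of_wiener_integral] := M_mean tT.
rewrite -(funext (past_kernel t)) => /(wint_unique bm (lexx 0) uT Yw).
by apply: filterS => w /= ->; rewrite /Z; ring.
Qed.

Let residual_path (w : Omega) : path_space T := fun t => Z (sval t) w.

Let measurable_residual (t : time T) : measurable_fun [set: Omega] (Z (sval t)).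
Proof. by have [_ _ ] := residual_wint (svalP t). Qed.

Let measurable_residual_path : measurable_fun [set: Omega] residual_path.
Proof. exact: measurable_path. Qed.

(** Each Z_t has a version measurable for the future, but the null sets vary over uncountably many
    t. Arguing on cylinder events inside the completion avoids a simultaneous version of the
    path. *)
Lemma residual_sub_future (A : set (path_space T)) : measurable A ->
  null_completion P future (residual_path @^-1` A).
Proof.
rewrite -[_ @^-1` A]setTI; move: A.
have sA := @sigma_algebra_image _ _ setT residual_path _
  (sigma_algebra_null_completion P future).
apply: (smallest_sub sA).
move=> _ [t [A [mA ->]]]; rewrite /image_set_system/= setTI.
split; first exact: (measurable_preimage (measurable_residual t)).
have [X' mX' ZX'] := wint_adapted (residual_wint (svalP t)).
exists (X' @^-1` A); first exact: gen_preimage.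
exact: eq_ae_eqset_null ZX'.
Qed.

Lemma independent_residual (D : set Omega) (A : set (path_space T)) :
  <<s history B u >> D -> measurable A ->
  P (D `&` residual_path @^-1` A) = (P D * P (residual_path @^-1` A))%E.
Proof.
move=> hD mA; apply: (independent_null_completion _ _ (independent_past_future bm u_range)).
- exact: increment_events_measurable.
- exact: increment_events_measurable.
- exact: history_sub_past.
- exact: residual_sub_future.
Qed.

Let shifted_path (w w' : Omega) : path_space T :=
  fun t => M (sval t) w + Z (sval t) w'.

Let measurable_shifted_path w : measurable_fun [set: Omega] (shifted_path w).
Proof.
by apply: measurable_path => t; exact: measurable_funD.
Qed.

(** Being an image of P for each frozen w, this is a probability measure without exceptional set. *)
Definition prediction_law (w : Omega) : probability (path_space T) R :=
  law P (measurable_shifted_path w).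

Local Notation Omega_u := (g_sigma_algebraType (history B u)).

(** The first factor carries only the past of [B], so measurability of section measures in w is the
    one that a regular conditional distribution demands. *)
Let shift_set (A : set (path_space T)) : set (Omega_u * path_space T) :=
  [set p | A (fun t => M (sval t) p.1 + p.2 t)].

Let measurable_shift_set A : measurable A -> measurable (shift_set A).
Proof.
move=> mA; pose add (p : Omega_u * path_space T) : path_space T :=
  fun t => M (sval t) p.1 + p.2 t.
suff madd : measurable_fun [set: Omega_u * path_space T] add.
  exact: (measurable_preimage madd mA).
apply: measurable_path => t; apply: measurable_funD.
  have [mM _] := M_mean (svalP t).
  exact: (measurableT_comp mM measurable_fst).
exact: (measurableT_comp (measurable_coordinate t) measurable_snd).
Qed.

Let prediction_lawE w A : prediction_law w A =
  law P measurable_residual_path (xsection (shift_set A) w).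
Proof.
apply: (congr1 P); apply/seteqP; split => w' /=; rewrite /xsection/=.
  by move=> ?; rewrite mem_set.
by move=> /set_mem.
Qed.

(** By independence the pair formed by w, seen through the past of [B], and the residual path has a
    product law; integrating sections over D gives the defining identity. *)
Lemma regular_prediction_law : regular_conditional_distribution P (history B u)
  (path_of (T := T) B) prediction_law.
Proof.
split=> [A mA|D A hD mA].
  rewrite (_ : (fun w => _) =
      (fun w => law P measurable_residual_path (xsection (shift_set A) w))).
    exact: (measurable_fun_xsection _ (measurable_shift_set mA)).
  by apply/funext => w; exact: prediction_lawE.
have mid : measurable_fun [set: Omega] (fun w : Omega => w : Omega_u).
  by move=> _ C hC; rewrite setTI; exact: (gen_measurable (@history_measurable B u)).
have mpair : measurable_fun [set: Omega]
    (fun w : Omega => (w : Omega_u, residual_path w)).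
  exact: measurable_fun_pair.
(* As B = M + Z, the event D with path in A is the preimage of [S] under the pair. *)
pose S := (D `*` [set: path_space T]) `&` shift_set A : set (Omega_u * path_space T).
have mD : measurable (D : set Omega_u) by exact: hD.
have mS : measurable S.
  by apply: measurableI; [exact: measurableX|exact: measurable_shift_set].
transitivity (image_measure P mpair S).
  rewrite /image_measure/= /pushforward; congr (P _).
  have shiftE w : shift_set A (w, residual_path w) = A (path_of B w).
    congr (A _); apply/funext => t.
    by rewrite /residual_path /Z /path_of/= addrC subrK.
  apply/seteqP; split => w /= [Dw Aw].
    by split; [split|rewrite shiftE].
  by split; [case: Dw|rewrite -shiftE].
rewrite -(@product_measure_unique _ _ _ _ _ (law P mid) (law P measurable_residual_path))//.
  rewrite /product_measure1/=.
  transitivity (\int[law P mid]_(w in D) prediction_law w A)%E.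
    rewrite [RHS]integral_mkcond; apply: eq_integral => w _.
    rewrite patchE; case: ifPn => wD.
      rewrite prediction_lawE; congr (law P _ _).
      apply/seteqP; split => z; rewrite /xsection/= !inE; first by case.
      by move=> ?; split => //; split => //; exact/set_mem.
    rewrite (_ : xsection _ _ = set0) ?measure0//.
    apply/seteqP; split => // z; rewrite /xsection/= inE => -[[/mem_set]].
    by rewrite (negbTE wD).
  rewrite ge0_integral_law//.
  rewrite (_ : (fun w => _) =
      (fun w => law P measurable_residual_path (xsection (shift_set A) w))).
    exact: (measurable_fun_xsection _ (measurable_shift_set mA)).
  by apply/funext => w; exact: prediction_lawE.
move=> C E hC mE; exact: independent_residual.
Qed.

Let residual_lty (t : time T) : (sqint P (Z (sval t)) < +oo)%E.
Proof. exact: (wint_lty bm u0 (lexx T) (residual_wint (svalP t))). Qed.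

Lemma prediction_law_mean w (t : time T) :
  ('E_(prediction_law w)[fun x : path_space T => x t] = (M (sval t) w)%:E)%E.
Proof.
have iZ : P.-integrable setT (EFin \o Z (sval t)).
  exact: (integrable_of_sqint (measurable_residual t) (residual_lty t)).
have iM : P.-integrable setT (fun=> (M (sval t) w)%:E).
  exact: finite_measure_integrable_cst.
rewrite unlock integral_law/=.
- rewrite /shifted_path; under eq_integral do rewrite EFinD.
  rewrite integralD//=; have := expectation_cst P (M (sval t) w); rewrite unlock/= => ->.
  by rewrite (wint_mean0 bm u0 (lexx T) (residual_wint (svalP t))) adde0.
- by apply/measurable_EFinP; exact: measurable_coordinate.
- rewrite (_ : _ \o _ = (fun w' => (M (sval t) w)%:E + (Z (sval t) w')%:E)%E).
    exact: integrableD.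
  by apply/funext => w' /=; rewrite /shifted_path EFinD.
Qed.

Lemma residual_covariance s t : 0 <= s <= T -> 0 <= t <= T ->
  (\int[P]_w (Z t w * Z s w)%R%:E = prediction_covariance n H B u t s)%E.
Proof.
move=> sT tT; rewrite (wint_covariance bm u0 (lexx T) (residual_wint tT) (residual_wint sT)).
rewrite /prediction_covariance /nfbm_covariance unlock.
rewrite (wint_covariance bm (lexx 0) (lexx T) (nfbm_wint tT) (nfbm_wint sT)).
have [mt too _ _] := nfbm_wint tT; have [ms soo _ _] := nfbm_wint sT.
have [mft fto _ _] := residual_wint tT.
have iK := @integrable_mul_sqr R _ _ leb (k t) (k s) mt ms too soo.
have iF := @integrable_mul_sqr R _ _ leb _ (k s) mft ms fto soo.
have -> : (\int[leb]_(x in `[0%R, u]) (k t x * k s x)%:E =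
    \int[leb]_x (k t x * k s x)%:E
    - \int[leb]_x ((u < x)%R%:R * k t x * k s x)%:E)%E.
  rewrite [LHS]integral_mkcond -integralB//; apply: eq_integral => x _ /=.
  rewrite patchE; case: ifPn => [|]; rewrite ?inE ?notin_setE/= in_itv/=.
    by move=> /andP[_ xu]; rewrite ltNge xu !mul0r sube0.
  move=> /negP; rewrite negb_and -!ltNge => /orP[x0|ux].
    by rewrite !fbm_kernel_out ?mulr0 ?sube0// negb_and -!leNgt ltW.
  by rewrite ux mul1r subee.
(* Cancellation in the extended reals is legitimate because both integrals are finite. *)
rewrite oppeB ?fin_num_adde_defr ?integrable_fin_num// addeA subee ?integrable_fin_num// add0e.
apply: eq_integral => x _; congr EFin.
by case: (u < x); rewrite ?mul0r ?mul1r.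
Qed.

Lemma gaussian_prediction_law w : gaussian_path_law (prediction_law w)
  (fun t => M (sval t) w)
  (fun t s => prediction_covariance n H B u (sval t) (sval s)).
Proof.
split; last 2 first.
- exact: prediction_law_mean.
- move=> t s; rewrite unlock !prediction_law_mean/= unlock integral_law/=.
  + rewrite -(residual_covariance (svalP s) (svalP t)).
    apply: eq_integral => w' _ /=; congr EFin.
    by rewrite /shifted_path /= !fctE/=; ring.
  + apply/measurable_EFinP; apply: measurable_funM;
      by apply: measurable_funB => //; exact: measurable_coordinate.
  + rewrite (_ : _ \o _ = (fun w' => (Z (sval t) w' * Z (sval s) w')%:E)).
      exact: (integrable_mul_sqr (measurable_residual t) (measurable_residual s)
        (residual_lty t) (residual_lty s)).
    by apply/funext => w' /=; congr EFin; rewrite /shifted_path !fctE/=; ring.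
move=> m t a.
(* Under the law at w, a combination of coordinates is a constant plus this Wiener integral over
   [u, T]; its variance is 0 when, for instance, all the times are at most u. *)
have Yw := wint_sum a uT (fun i => residual_wint (svalP (t i))).
have Yg := wint_gaussian bm u0 (lexx T) Yw.
set v := fine _ in Yg.
have v0 : 0 <= v by rewrite fine_ge0// sqint_ge0.
exists (\sum_(i < m) a i * M (sval (t i)) w), v; split => // A mA.
rewrite gaussian_law_affine//.
set c := \sum_(i < m) a i * _.
have mAc : measurable [set y | A (y + c)].
  have mc : measurable_fun [set: R] (fun y => y + c) by exact: measurable_funD.
  exact: (measurable_preimage mc mA).
have := centred_gaussianE v0 Yg mAc.
rewrite (_ : _ @^-1` [set y | A (y + c)] = (fun x => Num.sqrt v * x + c) @^-1` A)// => <-.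
have shiftE w' : \sum_(i < m) a i * shifted_path w w' (t i) =
    \sum_(i < m) a i * Z (sval (t i)) w' + c.
  by rewrite -big_split; apply: eq_bigr => i _; rewrite /shifted_path mulrDr addrC.
by apply: (congr1 P); apply/seteqP; split => w' /=; rewrite shiftE.
Qed.

End prediction_law.

Theorem theorem4p2 (R : realType) (n : nat) (H T u : R)
  (d : measure_display) (Omega : measurableType d) (P : probability Omega R)
  (W B : R -> {RV P >-> R})
  (n_ge1 : (1 <= n)%N) (H_range : n%:R - 1 < H < n%:R)
  (T_gt0 : 0 < T) (u_range : 0 <= u <= T)
  (W_bm : brownian_motion T W)
  (B_nfbm : nfbm n H T W B)
  (same_filtration : forall t : R, 0 <= t <= T ->
     eq_mod_null P <<s history W t >> <<s history B t >>) :
  (exists M : R -> Omega -> R, prediction_mean n H T W B u M) /\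
  (forall M : R -> Omega -> R, prediction_mean n H T W B u M ->
   exists Q : Omega -> probability (path_space T) R,
     regular_conditional_distribution P (history B u) (path_of (T := T) B) Q /\
     forall w : Omega,
       gaussian_path_law (Q w) (fun t => M (sval t) w)
         (fun t s => prediction_covariance n H B u (sval t) (sval s))).
Proof.
split; first exact: (prediction_mean_exists u_range W_bm B_nfbm same_filtration).
move=> M M_mean.
exists (prediction_law u_range W_bm B_nfbm M_mean); split.
  exact: regular_prediction_law.
exact: gaussian_prediction_law.
Qed.
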